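(* For all $n\geq 2$, the lower central series of $B_n(\mathbb{S}^2)$ is constant from the commutator subgroup onwards: $\Gamma_m(B_n(\mathbb{S}^2))=\Gamma_2(B_n(\mathbb{S}^2))$ for all $m\geq 2$. The subgroup $\Gamma_2(B_n(\mathbb{S}^2))$ is as follows. (1) If $n=1,2$ then $\Gamma_2(B_n(\mathbb{S}^2))=\{1\}$. (2) If $n=3$ then $\Gamma_2(B_3(\mathbb{S}^2))\cong\mathbb{Z}_3$. Thus $B_3(\mathbb{S}^2)\cong\mathbb{Z}_3\rtimes\mathbb{Z}_4$, the action being the non-trivial one. (3) If $n=4$ then $\Gamma_2(B_4(\mathbb{S}^2))$ admits a presentation with generators $g_1,g_2,g_3$, where $g_1=\sigma_1^2\sigma_2\sigma_1^{-3}$, $g_2=\sigma_1^3\sigma_2\sigma_1^{-4}$ and $g_3=\sigma_3\sigma_1^{-1}$, and defining relations $$g_3^4=1,\quad [g_3^2,g_1]=1,\quad [g_3^2,g_2]=1,\quad [g_3,g_2g_1]=1,$$ $$g_1^{-1}g_3^{-1}g_1=g_2g_3g_2^{-1},\quad g_1^{-1}g_3^{-1}g_1=g_1g_3g_1^{-1}g_3.$$ Furthermore, $\Gamma_2(B_4(\mathbb{S}^2))\cong\mathcal{Q}_8\rtimes_{\phi}\mathbb{F}_2(a,b)$, where $\mathcal{Q}_8=\langle x,y\mid x^2=y^2,\ xyx^{-1}=y^{-1}\rangle$ is the quaternion group of order $8$, $\mathbb{F}_2(a,b)$ is the free group of rank $2$ on $a,b$, and the action is given by $$\phi(a)(x)=y,\quad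 \phi(a)(y)=xy,\quad \phi(b)(x)=yx,\quad \phi(b)(y)=x.$$ (4) If $n=5$ then $\Gamma_2(B_5(\mathbb{S}^2))$ admits a presentation with generators $$w=\sigma_1^8,\qquad u_i=\sigma_1^{i-1}\sigma_2\sigma_1^{-i}\ (1\leq i\leq 8),\qquad v_1=\sigma_3\sigma_1^{-1},\ v_2=\sigma_4\sigma_1^{-1},$$ and defining relations $$v_1v_2v_1=v_2v_1v_2,\quad wv_i=v_iw\ (i=1,2),\quad u_1v_2=v_2u_2,\quad u_2v_2=v_2u_1^{-1}u_2,$$ $$u_iv_1u_{i+2}v_1^{-1}u_{i+1}^{-1}v_1^{-1}=1\ (1\leq i\leq 6),\quad u_7v_1wu_1w^{-1}v_1^{-1}u_8^{-1}v_1^{-1}=1,\quad u_8v_1wu_2v_1^{-1}u_1^{-1}w^{-1}v_1^{-1}=1,$$ $$u_{i+1}u_{i+2}^{-1}u_i^{-1}=1\ (1\leq i\leq 6),\quad u_8wu_1^{-1}w^{-1}u_7^{-1}=1,\quad wu_1u_2^{-1}w^{-1}u_8^{-1}=1,\quad u_2(v_1v_2^2v_1)u_7w=1.$$ If $n\geq 6$ then $\Gamma_2(B_n(\mathbb{S}^2))$ admits a presentation with generators $$u_1=\sigma_2\sigma_1^{-1},\quad u_2=\sigma_1\sigma_2\sigma_1^{-2},\quad v_i=\sigma_{i+2}\sigma_1^{-1}\ (1\leq i\leq n-3),$$ and the following defining relations, where $y=u_2^{-1}u_1u_2u_1^{-1}$ and $A=v_1\cdots v_{n-4}v_{n-3}^2v_{n-4}\cdots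 v_1$: $$v_iv_j=v_jv_i\ (|i-j|\geq 2),\quad v_iv_{i+1}v_i=v_{i+1}v_iv_{i+1}\ (1\leq i\leq n-4),\quad y \text{ commutes with } v_1,$$ $$v_ju_2v_j^{-1}=u_1\ \text{ and }\ v_ju_1v_j^{-1}=u_1u_2^{-1}\ (2\leq j\leq n-3),\quad u_1v_1u_1^{-1}u_2v_1^{-1}u_2^{-1}v_1^{-1}=1,$$ together with the following two relations: - if $2n-2=6k+6$ with $k\geq 0$: $u_1$ and $u_2$ both commute with $Ay^k$; - if $2n-2=6k+2$ with $k\geq 0$: $y^ku_1y^{-k}=A^{-1}u_2^{-1}y^{-1}A$ and $y^ku_2y^{-k}=A^{-1}u_2^{-1}u_1y^{-1}A$; - if $2n-2=6k+4$ with $k\geq 0$: $y^ku_1^{-1}y^{-k}=A^{-1}u_1^{-1}u_2A$ and $y^ku_2y^{-k}=A^{-1}u_2^{-1}u_1^{-1}u_2A$.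
   Context: For a surface $M$, $F_n(M)=\{(x_1,\ldots,x_n)\in M^n: x_i\neq x_j \text{ if } i\neq j\}$ is the $n$th configuration space, and $B_n(M)=\pi_1(F_n(M)/S_n)$ is the $n$-string braid group of $M$, where the symmetric group $S_n$ permutes coordinates. The group $B_n(\mathbb{S}^2)$ has generators $\sigma_1,\ldots,\sigma_{n-1}$ and defining relations $\sigma_i\sigma_j=\sigma_j\sigma_i$ if $|i-j|\geq 2$; $\sigma_i\sigma_{i+1}\sigma_i=\sigma_{i+1}\sigma_i\sigma_{i+1}$ for $1\leq i\leq n-2$; and $\sigma_1\cdots\sigma_{n-2}\sigma_{n-1}^2\sigma_{n-2}\cdots\sigma_1=1$. The lower central series of a group $G$ is $\Gamma_1(G)=G$, $\Gamma_{i+1}(G)=[G,\Gamma_i(G)]$. Commutators: $[g,h]=ghg^{-1}h^{-1}$. In $N\rtimes_\phi Q$, the normal subgroup is $N$ and $\phi:Q\to\mathrm{Aut}(N)$. $\mathbb{Z}_k$ denotes the cyclic group of order $k$.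
   Formalization: For n≥6 two printed relations are false and are corrected: ''y commutes with v_1'' is replaced by ''Ay^{-1} commutes with v_1'', and when 2n-2=6k+4 the first relation reads y^k u_1 y^{-k}=A^{-1}u_1^{-1}u_2A (u_1 in place of u_1^{-1}). *)

(* Defs.v *)
(* MathComp world; possibly infinite groups are the [groupType] of
   mathcomp.boot.monoid, and subsets of a group are classical sets. The group
   law of 'Z_k is addition modulo k. *)
From HB Require Import structures.
From mathcomp Require Import all_boot fingroup zmodp generic_quotient.
From mathcomp Require Import boolp classical_sets.

Set Implicit Arguments.
Unset Strict Implicit.
Unset Printing Implicit Defensive.

Local Open Scope quotient_scope.
Local Open Scope group_scope.

(** * Group words and presented groups *)

Inductive word (X : Type) : Type :=
| wgen of X
| wone
| wmul of word X & word X
| winv of word X.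
Arguments wone {X}.

(* [word X] carries the group operations but none of the group laws; this is
   only to write words with the notations of [group_scope]. *)
HB.instance Definition _ X := gen_eqMixin (word X).
HB.instance Definition _ X := gen_choiceMixin (word X).
HB.instance Definition _ X := hasMul.Build (word X) (@wmul X).
HB.instance Definition _ X := hasOne.Build (word X) wone.
HB.instance Definition _ X := hasInv.Build (word X) (@winv X).

(* A set of relations: [R u v] is the defining relation [u = v]. *)
Definition relations (X : Type) := word X -> word X -> Prop.

Section Presented.
Variables (X : Type) (R : relations X).

(* [conseq u v]: [u = v] follows from [R] and the group axioms. *)
Inductive conseq : word X -> word X -> Prop :=
| conseq_rel u v of R u v : conseq u v
| conseq_refl u : conseq u u
| conseq_sym u v of conseq u v : conseq v u
| conseq_trans u v w of conseq u v & conseq v w : conseq u w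
| conseq_mul u u' v v' of conseq u u' & conseq v v' : conseq (u * v) (u' * v')
| conseq_inv u u' of conseq u u' : conseq u^-1 u'^-1
| conseq_mulA u v w : conseq (u * (v * w)) (u * v * w)
| conseq_mul1 u : conseq (1 * u) u
| conseq_mulw1 u : conseq (u * 1) u
| conseq_mulV u : conseq (u^-1 * u) 1
| conseq_mulwV u : conseq (u * u^-1) 1.

Definition conseqb u v := `[< conseq u v >].

Lemma conseqb_refl : reflexive conseqb.
Proof. by move=> u; apply/asboolP; apply: conseq_refl. Qed.

Lemma conseqb_sym : symmetric conseqb.
Proof. by move=> u v; apply/asboolP/asboolP; apply: conseq_sym. Qed.

Lemma conseqb_trans : transitive conseqb.
Proof.
move=> v u w /asboolP uv /asboolP vw.
by apply/asboolP; apply: conseq_trans uv vw.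
Qed.

Definition conseq_equiv : equiv_rel (word X) :=
  EquivRel conseqb conseqb_refl conseqb_sym conseqb_trans.

Definition presented := {eq_quot conseq_equiv}.
HB.instance Definition _ := Choice.on presented.

Definition pclass (u : word X) : presented := \pi_presented u.

Lemma pclassP u v : pclass u = pclass v <-> conseq u v.
Proof. by split=> [/eqmodP/asboolP|uv] //; apply/eqmodP/asboolP. Qed.

Lemma pclass_repr (x : presented) : pclass (repr x) = x.
Proof. exact: reprK. Qed.

Definition pone : presented := pclass 1.
Definition pmul (x y : presented) : presented := pclass (repr x * repr y).
Definition pinv (x : presented) : presented := pclass (repr x)^-1.

Lemma repr_pclass u : conseq (repr (pclass u)) u.
Proof. by apply/pclassP; rewrite pclass_repr. Qed.

Lemma pclassM u v : pclass (u * v) = pmul (pclass u) (pclass v).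
Proof.
by apply/pclassP/conseq_sym/conseq_mul; apply: repr_pclass.
Qed.

Lemma pclassV u : pclass u^-1 = pinv (pclass u).
Proof. by apply/pclassP/conseq_sym/conseq_inv; apply: repr_pclass. Qed.

Lemma pmulA : associative pmul.
Proof.
move=> x y z; rewrite -[x]pclass_repr -[y]pclass_repr -[z]pclass_repr.
by rewrite -!pclassM; apply/pclassP/conseq_mulA.
Qed.

Lemma pmul1 : left_id pone pmul.
Proof.
by move=> x; rewrite -[x]pclass_repr -pclassM; apply/pclassP/conseq_mul1.
Qed.

Lemma pmulx1 : right_id pone pmul.
Proof.
by move=> x; rewrite -[x]pclass_repr -pclassM; apply/pclassP/conseq_mulw1.
Qed.

Lemma pmulV : left_inverse pone pinv pmul.
Proof.
move=> x; rewrite -[x]pclass_repr -pclassV -pclassM.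
by apply/pclassP/conseq_mulV.
Qed.

Lemma pmulxV : right_inverse pone pinv pmul.
Proof.
move=> x; rewrite -[x]pclass_repr -pclassV -pclassM.
by apply/pclassP/conseq_mulwV.
Qed.

HB.instance Definition _ :=
  isGroup.Build presented pmulA pmul1 pmulx1 pmulV pmulxV.

Definition pgen (x : X) : presented := pclass (wgen x).

End Presented.

(** * Subgroups, isomorphisms and the lower central series *)

(* The subset [S] of [G] is a subgroup isomorphic to [H]: an injective
   homomorphism [H -> G] with image [S] is an isomorphism of [H] onto [S]. *)
Definition isom_onto (H G : groupType) (S : set G) :=
  exists f : {multiplicative H -> G}, injective f /\ range f = S.

(* [S] admits a presentation with generators [g x] (x : X) and defining
   relations [R]. *)
Definition presents (G : groupType) (S : set G) (X : Type) (g : X -> G)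
    (R : relations X) :=
  exists f : {multiplicative presented R -> G},
    [/\ injective f, range f = S & forall x, f (pgen R x) = g x].

Definition is_subgroup (G : groupType) (S : set G) :=
  [/\ S 1, forall x y, S x -> S y -> S (x * y) & forall x, S x -> S x^-1].

(* The convention [g, h] = g h g^-1 h^-1 differs from MathComp's [~ g, h]. *)
Definition comm (M : baseGroupType) (g h : M) : M := g * h * g^-1 * h^-1.

Section LowerCentralSeries.
Variable G : groupType.

(* The series is indexed from 1; index 0 also gives the whole group. *)
Fixpoint lcs (m : nat) : set G :=
  match m with
  | 0 | 1 => [set: G]
  | (_.+1 as k).+1 =>
      smallest (@is_subgroup G) [set z | exists g h, lcs k h /\ z = comm g h]
  end.
End LowerCentralSeries.
Arguments lcs : clear implicits.

(** * Semidirect products *)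

(* A homomorphism [Q -> Aut N]; each [act q] is bijective, with inverse
   [act q^-1]. *)
Record gaction (Q N : groupType) := GAction {
  act :> Q -> N -> N;
  actM : forall q, {morph act q : x y / x * y};
  act1 : forall x, act 1 x = x;
  act_comp : forall p q x, act (p * q) x = act p (act q x)
}.

(* N x| Q for the action [phi] *)
Definition semidirect (Q N : groupType) (phi : gaction Q N) : Type :=
  (N * Q)%type.

Section Semidirect.
Variables (Q N : groupType) (phi : gaction Q N).

HB.instance Definition _ := Choice.on (semidirect phi).

Definition sd_one : semidirect phi := (1, 1).
Definition sd_mul (a b : semidirect phi) : semidirect phi :=
  (a.1 * phi a.2 b.1, a.2 * b.2).
Definition sd_inv (a : semidirect phi) : semidirect phi :=
  (phi a.2^-1 a.1^-1, a.2^-1).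

Lemma act_one q : phi q 1 = 1.
Proof. by apply: (mulgI (phi q 1)); rewrite -actM !mulg1. Qed.

Lemma sd_mulA : associative sd_mul.
Proof. by case=> [a p] [b q] [c r]; rewrite /sd_mul /= actM act_comp !mulgA. Qed.

Lemma sd_mul1 : left_id sd_one sd_mul.
Proof. by case=> [a p]; rewrite /sd_mul /= act1 !mul1g. Qed.

Lemma sd_mulx1 : right_id sd_one sd_mul.
Proof. by case=> [a p]; rewrite /sd_mul /= act_one !mulg1. Qed.

Lemma sd_mulV : left_inverse sd_one sd_inv sd_mul.
Proof. by case=> [a p]; rewrite /sd_mul /= -actM !mulVg act_one. Qed.

Lemma sd_mulxV : right_inverse sd_one sd_inv sd_mul.
Proof. by case=> [a p]; rewrite /sd_mul /= -act_comp !mulgV act1 mulgV. Qed.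

HB.instance Definition _ :=
  isGroup.Build (semidirect phi) sd_mulA sd_mul1 sd_mulx1 sd_mulV sd_mulxV.

End Semidirect.

(** * The sphere braid groups *)

(* The [i]-th member, counting from 1, of a family of [m] elements; it is 1
   for [i] out of range, where it is never used. *)
Definition nth1 (M : baseUMagmaType) (m : nat) (s : 'I_m -> M) (i : nat) : M :=
  if i is k.+1 then (if insub k is Some j then s j else 1) else 1.

Definition sb_gen (n i : nat) : word 'I_n.-1 := nth1 (@wgen 'I_n.-1) i.
Arguments sb_gen : clear implicits.

Section SphereBraid.
Variable n : nat.
Local Notation s := (sb_gen n).

Inductive sphere_braid_rel : relations 'I_n.-1 :=
| sb_far i j of 1 <= i <= n - 1 & 1 <= j <= n - 1
      & (i + 2 <= j) || (j + 2 <= i) :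
    sphere_braid_rel (s i * s j) (s j * s i)
| sb_braid i of 1 <= i <= n - 2 :
    sphere_braid_rel (s i * s i.+1 * s i) (s i.+1 * s i * s i.+1)
| sb_sphere :
    sphere_braid_rel
      ((\prod_(1 <= i < n - 1) s i) * s (n - 1) ^+ 2
         * \prod_(1 <= i < n - 1) s (n - 1 - i)) 1.
End SphereBraid.
Arguments sphere_braid_rel : clear implicits.

(* [B] with the elements [sigma 1], ..., [sigma (n-1)] is the group B_n(S^2)
   with its standard generators: pi_1(F_n(S^2)/S_n) has this presentation, by
   Fadell and Van Buskirk. The other values of [sigma] are irrelevant. *)
Definition is_sphere_braid_group (n : nat) (B : groupType) (sigma : nat -> B) :=
  presents [set: B] (fun i : 'I_n.-1 => sigma i.+1) (sphere_braid_rel n).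

(** * The quaternion group and the free group of rank 2 *)

Inductive Q8_gen := Q8_x | Q8_y.

Inductive Q8_rel : relations Q8_gen :=
| Q8_sq : Q8_rel (wgen Q8_x ^+ 2) (wgen Q8_y ^+ 2)
| Q8_conj : Q8_rel (wgen Q8_x * wgen Q8_y * (wgen Q8_x)^-1) (wgen Q8_y)^-1.

Definition Q8 : groupType := presented Q8_rel.
Definition Qx : Q8 := pgen Q8_rel Q8_x.
Definition Qy : Q8 := pgen Q8_rel Q8_y.

Inductive F2_gen := F2_a | F2_b.

Definition F2_rel : relations F2_gen := fun _ _ => False.

Definition F2 : groupType := presented F2_rel.
Definition Fa : F2 := pgen F2_rel F2_a.
Definition Fb : F2 := pgen F2_rel F2_b.

(** * Presentations of the commutator subgroups *)

Inductive gens4 := G4_1 | G4_2 | G4_3.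

Section Family4.
Variables (B : groupType) (sigma : nat -> B).

Definition family4 (x : gens4) : B :=
  match x with
  | G4_1 => sigma 1 ^+ 2 * sigma 2 * sigma 1 ^- 3
  | G4_2 => sigma 1 ^+ 3 * sigma 2 * sigma 1 ^- 4
  | G4_3 => sigma 3 * (sigma 1)^-1
  end.
End Family4.

Section Rel4.
Local Notation g1 := (wgen G4_1).
Local Notation g2 := (wgen G4_2).
Local Notation g3 := (wgen G4_3).

Inductive rel4 : relations gens4 :=
| rel4_ord : rel4 (g3 ^+ 4) 1
| rel4_c1 : rel4 (comm (g3 ^+ 2) g1) 1
| rel4_c2 : rel4 (comm (g3 ^+ 2) g2) 1
| rel4_c3 : rel4 (comm g3 (g2 * g1)) 1
| rel4_j1 : rel4 (g1^-1 * g3^-1 * g1) (g2 * g3 * g2^-1)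
| rel4_j2 : rel4 (g1^-1 * g3^-1 * g1) (g1 * g3 * g1^-1 * g3).
End Rel4.

Inductive gens5 := G5_w | G5_u of 'I_8 | G5_v of 'I_2.

(* In [G5_u i], [G5_v i] and [G6_v i] below, the ordinal [i] stands for the
   index [i + 1]. *)
Section Family5.
Variables (B : groupType) (sigma : nat -> B).

Definition family5 (x : gens5) : B :=
  match x with
  | G5_w => sigma 1 ^+ 8
  | G5_u i => sigma 1 ^+ i * sigma 2 * sigma 1 ^- i.+1
  | G5_v i => sigma i.+3 * (sigma 1)^-1
  end.
End Family5.

Definition u5 (i : nat) : word gens5 := nth1 (fun j => wgen (G5_u j)) i.
Definition v5 (i : nat) : word gens5 := nth1 (fun j => wgen (G5_v j)) i.

Section Rel5.
Local Notation w := (wgen G5_w).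
Local Notation u := u5.
Local Notation v := v5.

Inductive rel5 : relations gens5 :=
| rel5_vv : rel5 (v 1 * v 2 * v 1) (v 2 * v 1 * v 2)
| rel5_wv i of 1 <= i <= 2 : rel5 (w * v i) (v i * w)
| rel5_u1v2 : rel5 (u 1 * v 2) (v 2 * u 2)
| rel5_u2v2 : rel5 (u 2 * v 2) (v 2 * (u 1)^-1 * u 2)
| rel5_uv i of 1 <= i <= 6 :
    rel5 (u i * v 1 * u i.+2 * (v 1)^-1 * (u i.+1)^-1 * (v 1)^-1) 1
| rel5_uv7 :
    rel5 (u 7 * v 1 * w * u 1 * w^-1 * (v 1)^-1 * (u 8)^-1 * (v 1)^-1) 1
| rel5_uv8 :
    rel5 (u 8 * v 1 * w * u 2 * (v 1)^-1 * (u 1)^-1 * w^-1 * (v 1)^-1) 1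
| rel5_u i of 1 <= i <= 6 : rel5 (u i.+1 * (u i.+2)^-1 * (u i)^-1) 1
| rel5_u7 : rel5 (u 8 * w * (u 1)^-1 * w^-1 * (u 7)^-1) 1
| rel5_u8 : rel5 (w * u 1 * (u 2)^-1 * w^-1 * (u 8)^-1) 1
| rel5_sphere : rel5 (u 2 * (v 1 * v 2 ^+ 2 * v 1) * u 7 * w) 1.
End Rel5.

Inductive gens6 (n : nat) := G6_u1 | G6_u2 | G6_v of 'I_(n - 3).
Arguments G6_u1 {n}.
Arguments G6_u2 {n}.

Section Family6.
Variables (n : nat) (B : groupType) (sigma : nat -> B).

Definition family6 (x : gens6 n) : B :=
  match x with
  | G6_u1 => sigma 2 * (sigma 1)^-1
  | G6_u2 => sigma 1 * sigma 2 * sigma 1 ^- 2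
  | G6_v i => sigma i.+3 * (sigma 1)^-1
  end.
End Family6.

Section Rel6.
Variable n : nat.
Local Notation u1 := (@wgen (gens6 n) G6_u1).
Local Notation u2 := (@wgen (gens6 n) G6_u2).
Definition v6 (i : nat) : word (gens6 n) := nth1 (fun j => wgen (G6_v j)) i.
Local Notation v := v6.
Definition y6 : word (gens6 n) := u2^-1 * u1 * u2 * u1^-1.
Local Notation y := y6.
Definition A6 : word (gens6 n) :=
  (\prod_(1 <= i < n - 3) v i) * v (n - 3) ^+ 2
    * \prod_(1 <= i < n - 3) v (n - 3 - i).
Local Notation A := A6.

(* Two of the relations correct the literature, where they read as follows
   and are false:
   - [rel6_Ayv]: "y commutes with v_1". The relation expresses that
     w = sigma_1^(2n-2) commutes with v_1, and w = y A^-1; but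
     y = sigma_1^6 (sigma_1 sigma_2)^-3 does not commute with v_1.
   - [rel6_4u1]: "y^k u_1^-1 y^-k = A^-1 u_1^-1 u_2 A". In the symmetric group
     (sigma_i |-> (i i+1)), y and A are trivial and u_2 = u_1^-1 is a 3-cycle,
     while this reads u_2 = 1. *)
Inductive rel6 : relations (gens6 n) :=
| rel6_far i j of 1 <= i <= n - 3 & 1 <= j <= n - 3
      & (i + 2 <= j) || (j + 2 <= i) : rel6 (v i * v j) (v j * v i)
| rel6_braid i of 1 <= i <= n - 4 :
    rel6 (v i * v i.+1 * v i) (v i.+1 * v i * v i.+1)
| rel6_Ayv : rel6 (A * y^-1 * v 1) (v 1 * (A * y^-1))
| rel6_vu2 j of 2 <= j <= n - 3 : rel6 (v j * u2 * (v j)^-1) u1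
| rel6_vu1 j of 2 <= j <= n - 3 : rel6 (v j * u1 * (v j)^-1) (u1 * u2^-1)
| rel6_uv :
    rel6 (u1 * v 1 * u1^-1 * u2 * (v 1)^-1 * u2^-1 * (v 1)^-1) 1
| rel6_6u1 k of (2 * n - 2 = 6 * k + 6)%N :
    rel6 (u1 * (A * y ^+ k)) (A * y ^+ k * u1)
| rel6_6u2 k of (2 * n - 2 = 6 * k + 6)%N :
    rel6 (u2 * (A * y ^+ k)) (A * y ^+ k * u2)
| rel6_2u1 k of (2 * n - 2 = 6 * k + 2)%N :
    rel6 (y ^+ k * u1 * y ^- k) (A^-1 * u2^-1 * y^-1 * A)
| rel6_2u2 k of (2 * n - 2 = 6 * k + 2)%N :
    rel6 (y ^+ k * u2 * y ^- k) (A^-1 * u2^-1 * u1 * y^-1 * A)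
| rel6_4u1 k of (2 * n - 2 = 6 * k + 4)%N :
    rel6 (y ^+ k * u1 * y ^- k) (A^-1 * u1^-1 * u2 * A)
| rel6_4u2 k of (2 * n - 2 = 6 * k + 4)%N :
    rel6 (y ^+ k * u2 * y ^- k) (A^-1 * u2^-1 * u1^-1 * u2 * A).
End Rel6.
Arguments rel6 : clear implicits.

(* Main.v *)
(** For n >= 2 the quotient of B_n(S^2) by its commutator subgroup is cyclic of
    order m = 2n - 2, generated by the class of t = sigma_1. So let K be the
    group presented by the claimed generators and relations. Conjugation by t
    induces an automorphism alpha of K, and t^m is an element w of K such that
    alpha w = w and alpha^m is the conjugation by w; hence K embeds into an
    extension E containing an element T that acts on K as alpha and satisfies
    T^m = w. The elements of E corresponding to the sigma_i satisfy the defining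
    relations of B_n(S^2), and the resulting map B_n(S^2) -> E is the inclusion
    K -> E on the given generators of the commutator subgroup, so the map
    K -> B_n(S^2) is injective; its image is normal with abelian quotient.

    With u_i = t^(i-1) sigma_2 t^(-i), alpha maps u_i to u_(i+1), and the braid
    relation between sigma_1 and sigma_2 says that u_(i+2) = u_i^-1 u_(i+1).
    This recursion has "period 6 up to conjugation": u_(i+6) = y u_i y^-1, where the
    commutator y = u_(i+1)^-1 u_i u_(i+1) u_i^-1 does not depend on i. This is
    why the relations for n >= 6 depend on 2n - 2 modulo 6. *)

Require Import Defs.
From HB Require Import structures.
From mathcomp Require Import all_boot fingroup zmodp zify.
From mathcomp Require Import boolp classical_sets.

Set Implicit Arguments.
Unset Strict Implicit.
Unset Printing Implicit Defensive.

Local Open Scope group_scope.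

(** * Morphisms and presentations *)

Definition mk_gmorph (G H : groupType) (f : G -> H)
    (fM : {morph f : x y / x * y}) : {multiplicative G -> H} :=
  HB.pack_for {multiplicative G -> H} f (isMultiplicative.Build G H f fM).

Section Multiplicative.
Variables (G H : groupType) (f : {multiplicative G -> H}).

Lemma gmorph1 : f 1 = 1.
Proof. by apply: (mulgI (f 1)); rewrite -gmulfM !mulg1. Qed.

Lemma gmorphV x : f x^-1 = (f x)^-1.
Proof. by apply/divg1_eq; rewrite invgK -gmulfM mulVg gmorph1. Qed.

Lemma gmorphX x n : f (x ^+ n) = f x ^+ n.
Proof. by elim: n => [|n IHn]; rewrite ?gmorph1 // !expgS gmulfM IHn. Qed.

End Multiplicative.

Lemma gmorph_inj (G H : groupType) (f : {multiplicative G -> H}) :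
  (forall x, f x = 1 -> x = 1) -> injective f.
Proof.
move=> f1 x y fxy; apply/divg1_eq/f1.
by rewrite gmulfM gmorphV fxy mulgV.
Qed.

Lemma equalizer_subgroup (G H : groupType) (f g : {multiplicative G -> H}) :
  is_subgroup [set x | f x = g x]%classic.
Proof.
split=> [|x y /= fx fy|x /= fx]; first by rewrite /= !gmorph1.
- by rewrite !gmulfM fx fy.
- by rewrite !gmorphV fx.
Qed.

Section WordEvaluation.
Variables (X : Type) (G : groupType) (g : X -> G).

Fixpoint weval (w : word X) : G :=
  match w with
  | wgen x => g x
  | wone => 1
  | wmul u v => weval u * weval v
  | winv u => (weval u)^-1
  end.

Lemma weval1 : weval 1 = 1. Proof. by []. Qed.

Lemma wevalM u v : weval (u * v) = weval u * weval v. Proof. by []. Qed.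

Lemma wevalV u : weval u^-1 = (weval u)^-1. Proof. by []. Qed.

Lemma wevalX u n : weval (u ^+ n) = weval u ^+ n.
Proof. by case: n => // n; elim: n => // n IHn; rewrite !expgSS wevalM IHn. Qed.

Lemma weval_prod I (r : seq I) (P : pred I) (F : I -> word X) :
  weval (\prod_(i <- r | P i) F i) = \prod_(i <- r | P i) weval (F i).
Proof. exact: (big_morph weval wevalM weval1). Qed.

Lemma weval_nth1 m (F : 'I_m -> word X) (c : nat -> G) i :
  (forall j, weval (F j) = c j.+1) -> 1 <= i <= m -> weval (nth1 F i) = c i.
Proof.
move=> Fc; case: i => // i /= lt_im; rewrite insubT; exact: Fc.
Qed.

End WordEvaluation.

Definition wevalE := (wevalX, wevalM, wevalV, weval1, weval_prod).

Definition satisfies (X : Type) (R : relations X) (G : groupType)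
    (g : X -> G) :=
  forall u v, R u v -> weval g u = weval g v.

Section Presented.
Variables (X : Type) (R : relations X).

Lemma satisfies_conseq (G : groupType) (g : X -> G) u v :
  satisfies R g -> conseq R u v -> weval g u = weval g v.
Proof.
move=> Rg; elim=> {u v} //=.
- by move=> u v w _ -> _ ->.
- by move=> u u' v v' _ -> _ ->.
- by move=> u u' _ ->.
- by move=> u v w; rewrite mulgA.
- by move=> u; rewrite mul1g.
- by move=> u; rewrite mulg1.
- by move=> u; rewrite mulVg.
- by move=> u; rewrite mulgV.
Qed.

Lemma pclass_weval w : pclass R w = weval (pgen R) w.
Proof.
elim: w => //= [u IHu v IHv|u IHu].
- by rewrite -IHu -IHv -[LHS]/(pclass R (u * v)) pclassM.
- by rewrite -IHu -[LHS]/(pclass R u^-1) pclassV.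
Qed.

Lemma satisfies_pgen : satisfies R (pgen R).
Proof.
by move=> u v Ruv; rewrite -!pclass_weval; apply/pclassP/conseq_rel.
Qed.

(** Von Dyck's theorem: the value of a representative word does not depend on its choice, because
    [g] satisfies the relations. *)
Lemma presented_lift (G : groupType) (g : X -> G) : satisfies R g ->
  exists f : {multiplicative presented R -> G}, forall x, f (pgen R x) = g x.
Proof.
move=> Rg; pose f (x : presented R) : G := weval g (generic_quotient.repr x).
have fE u : f (pclass R u) = weval g u.
  by apply: satisfies_conseq; [exact: Rg | apply: repr_pclass].
have fM : {morph f : x y / x * y} by move=> x y; rewrite [LHS]fE.
by exists (mk_gmorph fM) => x; rewrite [LHS]fE.
Qed.

Lemma presented_ind (P : set (presented R)) :
  is_subgroup P -> (forall x, P (pgen R x)) -> forall x, P x.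
Proof.
move=> [P1 PM PV] Pgen x; rewrite -[x]pclass_repr pclass_weval.
by elim: (generic_quotient.repr x) => //= [u Pu v Pv|u Pu];
  [apply: PM | apply: PV].
Qed.

Lemma presented_ext (G : groupType) (f g : {multiplicative presented R -> G}) :
  (forall x, f (pgen R x) = g (pgen R x)) -> f =1 g.
Proof. by move=> fg x; apply: (presented_ind (equalizer_subgroup f g)). Qed.

Lemma gmorph_weval (G H : groupType) (f : {multiplicative G -> H})
    (g : X -> G) w :
  f (weval g w) = weval (f \o g) w.
Proof.
elim: w => [||u IHu v IHv|u IHu] /=; rewrite ?gmorph1 //.
- by rewrite gmulfM IHu IHv.
- by rewrite gmorphV IHu.
Qed.

Lemma eq_weval (G : groupType) (f g : X -> G) : f =1 g -> weval f =1 weval g.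
Proof. by move=> fg; elim=> //= [u -> v ->|u ->]. Qed.

End Presented.

Section PresentedGroup.
Variables (X : Type) (R : relations X) (B : groupType) (s : X -> B).
Hypothesis sP : presents [set: B]%classic s R.

Lemma presents_satisfies : satisfies R s.
Proof.
move=> u v /satisfies_pgen Ruv; case: sP => f [_ _ fs].
have sE : s =1 f \o pgen R by move=> x; rewrite /= fs.
by rewrite !(eq_weval sE) -!gmorph_weval Ruv.
Qed.

Lemma presents_ind (P : set B) :
  is_subgroup P -> (forall x, P (s x)) -> forall b, P b.
Proof.
case: sP => f [_ fS fs] [P1 PM PV] Ps b.
have [x _ <-] : range f b by rewrite fS.
apply: (presented_ind (P := fun x => P (f x))) x => [|x]; last by rewrite fs.
split=> [|x y Px Py|x Px]; rewrite ?gmorph1 ?gmulfM ?gmorphV //; first exact: PM.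
exact: PV.
Qed.

Lemma presents_lift (E : groupType) (c : X -> E) : satisfies R c ->
  exists h : {multiplicative B -> E}, forall x, h (s x) = c x.
Proof.
move=> /(@presented_lift _ _)[h0 h0c]; case: sP => f [f_inj fS fs].
have /choice[g gK] (b : B) : exists x, f x = b.
  by have [x _ <-] : range f b; [rewrite fS | exists x].
have hM : {morph (fun b => h0 (g b)) : x y / x * y}.
  by move=> x y; rewrite -gmulfM; congr (h0 _); apply: f_inj; rewrite gmulfM !gK.
exists (mk_gmorph hM) => x /=.
by rewrite -h0c; congr (h0 _); apply: f_inj; rewrite gK fs.
Qed.

End PresentedGroup.

(** * The lower central series *)

Section Commutators.
Variable G : groupType.
Implicit Types (N : set G) (g h x : G).

Definition is_normal N := forall x z, N z -> N (x * z * x^-1).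

Lemma comm_mull g h x : comm (g * h) x = g * comm h x * g^-1 * comm g x.
Proof. by rewrite /comm !gnorm. Qed.

Lemma comm_invl g x : comm g^-1 x = g^-1 * (comm g x)^-1 * g^-1^-1.
Proof. by rewrite /comm !gnorm. Qed.

Lemma comm_inv g h : (comm g h)^-1 = comm h g.
Proof. by rewrite /comm !gnorm. Qed.

Lemma comm_conj x g h :
  x * comm g h * x^-1 = comm (x * g * x^-1) (x * h * x^-1).
Proof. by rewrite /comm !gnorm. Qed.

(** When [g] and [h] lie in a normal subgroup, this reduces a commutator of two elements of one
    coset to commutators with an entry in the subgroup. *)
Lemma comm_same_coset g h x :
  comm (g * x) (h * x) = g * comm x (h * g^-1) * g^-1 * comm g h.
Proof. by rewrite /comm !gnorm. Qed.

Lemma centralizer_mod_subgroup N x : is_subgroup N -> is_normal N ->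
  is_subgroup [set g | N (comm g x)]%classic.
Proof.
move=> [N1 NM NV] Nn; split=> [|g h|g] /=.
- by rewrite /mkset /comm !gnorm.
- by move=> Ng Nh; rewrite comm_mull; apply: NM => //; apply: Nn.
- by move=> Ng; rewrite comm_invl; apply/Nn/NV.
Qed.

Lemma lcsSE m : lcs G m.+2 = smallest (@is_subgroup G)
  [set z | exists g h, lcs G m.+1 h /\ z = comm g h]%classic.
Proof. by []. Qed.

Lemma lcs_subgroup m : is_subgroup (lcs G m).
Proof.
case: m => [|[|m]]; [by split | by split |].
split=> [N [[]]//|x y Nx Ny N NP|x Nx N NP]; have [[_ NM NV] _] := NP.
- by apply: NM; [apply: Nx | apply: Ny].
- by apply: NV; apply: Nx.
Qed.

Lemma lcs_comm m g h : lcs G m.+1 h -> lcs G m.+2 (comm g h).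
Proof. by move=> Gg N [_]; apply; exists g, h. Qed.

Lemma lcs_min m N : is_subgroup N ->
  (forall g h, lcs G m.+1 h -> N (comm g h)) -> (lcs G m.+2 `<=` N)%classic.
Proof.
move=> Nsub Ncomm z; apply; split=> // _ [g] [h] [Gg ->]; exact: Ncomm.
Qed.

Lemma lcs_normal m : is_normal (lcs G m).
Proof.
case: m => [|m] //; elim: m => // m IHm x z.
apply: (lcs_min (N := [set z | lcs G m.+2 (x * z * x^-1)]%classic)) z.
  have [N1 NM NV] := lcs_subgroup m.+2.
  split=> [|y z Ny Nz|y Ny]; first by rewrite /mkset mulg1 mulgV.
  - by have := NM _ _ Ny Nz; rewrite /mkset !gnorm.
  - by have := NV _ Ny; rewrite /mkset !gnorm.
by move=> g h Gh; rewrite /mkset comm_conj; apply: lcs_comm; apply: IHm.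
Qed.

Lemma lcs2_comm g h : lcs G 2 (comm g h).
Proof. exact: lcs_comm. Qed.

End Commutators.

Section GeneratedCommutators.
Variables (X : Type) (R : relations X) (B : groupType) (s : X -> B).
Hypothesis sP : presents [set: B]%classic s R.

(** Centralizers modulo [N] are subgroups, so commutation modulo [N] spreads from the generators to
    all elements, in one argument and then in the other. *)
Lemma commutative_mod (N : set B) : is_subgroup N -> is_normal N ->
  (forall x y, N (comm (s x) (s y))) -> forall g h, N (comm g h).
Proof.
move=> Nsub Nn Ns; have Cs := centralizer_mod_subgroup _ Nsub Nn.
have Ng y g : N (comm g (s y)).
  by apply: (presents_ind sP (Cs (s y))) => x; apply: Ns.
move=> g h; rewrite -comm_inv; case: (Nsub) => _ _; apply.
apply: (presents_ind sP (Cs g)) h => x; rewrite /mkset -comm_inv.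
by case: Nsub => _ _; apply; apply: Ng.
Qed.

Lemma lcs2_trivial : (forall x y, s x * s y = s y * s x) ->
  lcs B 2 = [set 1]%classic.
Proof.
move=> sC; have N1 : is_subgroup [set (1 : B)]%classic.
  by split=> // [x y -> ->|x ->]; rewrite /set1 /mkset ?mulg1 ?invg1.
apply/seteqP; split=> [|_ ->]; last by case: (lcs_subgroup B 2).
apply: lcs_min => // g h _; apply: commutative_mod => // [x z ->|x y].
  by rewrite /set1 /mkset mulg1 mulgV.
by rewrite /comm sC /set1 /mkset !gnorm.
Qed.

(* Modulo the third term the second one is central, so the generators, all
   congruent to [t] modulo the second term, commute. *)
Lemma lcs_stable (t : B) : (forall x, lcs B 2 (s x * t^-1)) ->
  forall m, 2 <= m -> lcs B m = lcs B 2.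
Proof.
move=> st; have [_ N2M N2V] := lcs_subgroup B 2.
have [_ N3M N3V] := lcs_subgroup B 3; have N3n := @lcs_normal B 3.
have lcs32 : lcs B 3 = lcs B 2.
  apply/seteqP; split=> [|z].
    apply: lcs_min => [|g h _]; [exact: lcs_subgroup | exact: lcs2_comm].
  apply: (lcs_min (m := 0)) => [|g h _]; first exact: lcs_subgroup.
  apply: commutative_mod => // [|x y]; first exact: lcs_subgroup.
  rewrite -[s x](mulgVK t) -[s y](mulgVK t) comm_same_coset.
  apply: N3M; last by apply: lcs_comm; apply: st.
  by apply: N3n; apply: lcs_comm; apply: N2M => //; apply: N2V.
case=> [|[|m]] // _; elim: m => // m IHm.
by rewrite lcsSE IHm -lcsSE.
Qed.

End GeneratedCommutators.

(** * Cyclic extensions *)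

Section Bijections.
Variable S : Type.

(** The symmetric group of an arbitrary, possibly infinite, type; the cyclic extension is realized
    inside such a group. *)
Record bij := Bij {
  bij_fun :> S -> S;
  bij_inv : S -> S;
  bij_funK : cancel bij_fun bij_inv;
  bij_invK : cancel bij_inv bij_fun
}.

Lemma bij_eq (p q : bij) : p =1 q -> p = q.
Proof.
case: p q => [f f' fK f'K] [g g' gK g'K] /= fg.
have {fg} fg : f = g by apply/funext.
subst g; have fg' : f' = g' by apply/funext => x; rewrite -[f' x]gK f'K.
by subst g'; congr Bij; apply: Prop_irrelevance.
Qed.

HB.instance Definition _ := gen_eqMixin bij.
HB.instance Definition _ := gen_choiceMixin bij.

Definition bij_one : bij := @Bij id id (frefl id) (frefl id).
Definition bij_mul (p q : bij) : bij :=
  Bij (can_comp (bij_funK p) (bij_funK q))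
      (can_comp (bij_invK q) (bij_invK p)).
Definition bij_invg (p : bij) : bij := Bij (bij_invK p) (bij_funK p).

Lemma bij_mulA : associative bij_mul.
Proof. by move=> p q r; apply: bij_eq. Qed.

Lemma bij_mul1 : left_id bij_one bij_mul.
Proof. by move=> p; apply: bij_eq. Qed.

Lemma bij_mulx1 : right_id bij_one bij_mul.
Proof. by move=> p; apply: bij_eq. Qed.

Lemma bij_mulV : left_inverse bij_one bij_invg bij_mul.
Proof. by move=> p; apply: bij_eq => x; apply: bij_funK. Qed.

Lemma bij_mulxV : right_inverse bij_one bij_invg bij_mul.
Proof. by move=> p; apply: bij_eq => x; apply: bij_invK. Qed.

HB.instance Definition _ :=
  isGroup.Build bij bij_mulA bij_mul1 bij_mulx1 bij_mulV bij_mulxV.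

Lemma bijM (p q : bij) x : (p * q) x = p (q x). Proof. by []. Qed.

Lemma bijX (p : bij) n x : (p ^+ n) x = iter n p x.
Proof. by elim: n => // n IHn; rewrite expgS bijM IHn. Qed.

End Bijections.

(* An element [T] with [T k T^-1 = alpha k] and [T ^+ m = w] can be adjoined to
   the group [K]: let [K] act on the cosets of [K] in the extension, [T ^+ i]
   standing for the coset with index [i]. *)
Section CyclicExtension.
Variables (K : groupType) (alpha : {multiplicative K -> K}) (w : K) (p : nat).
Hypothesis alpha_w : alpha w = w.
Hypothesis alpha_iter : forall k, iter p.+1 alpha k = w * k * w^-1.

Let S := (K * 'I_p.+1)%type.
(** A pair [(k, i)] stands for [k T^i]; [trans k] and [shift] are left multiplication by [k] and by
    [T]. The factor [w] appears when the exponent passes [p], since [T^(p+1) = w]. *)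
Let trans (k : K) (x : S) : S := (k * x.1, x.2).
Let shift (x : S) : S :=
  if x.2 == p :> nat then (alpha x.1 * w, ord0)
  else (alpha x.1, inord x.2.+1).

Let iter_alphaM j k l : iter j alpha (k * l) = iter j alpha k * iter j alpha l.
Proof. by elim: j => //= j ->; rewrite gmulfM. Qed.

Let iter_alpha_w j : iter j alpha w = w.
Proof. by elim: j => //= j ->. Qed.

Let iter_shift j k (i : 'I_p.+1) : i + j <= p ->
  iter j shift (k, i) = (iter j alpha k, inord (i + j)).
Proof.
elim: j => [|j IHj] ltp /=; first by rewrite addn0 inord_val.
rewrite addnS in ltp *; have lep := ltnW ltp.
by rewrite IHj // /shift /= inordK // (ltn_eqF ltp).
Qed.

(** The cycle is split at the wrap: [p - i] steps up to index [p], one step that inserts [w], and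
    [i] steps back up to [i]. The first component becomes [alpha^(p+1)(k) w], which is [w k]. *)
Let shift_cycle x : iter p.+1 shift x = trans w x.
Proof.
case: x => k i; have lei : i <= p by rewrite -ltnS.
have iterE T (g : T -> T) x : iter p.+1 g x = iter i g (g (iter (p - i) g x)).
  by rewrite -iterS -iterD addnS subnKC.
rewrite iterE iter_shift subnKC // {2}/shift /= inordK // eqxx iter_shift //.
rewrite add0n inord_val iter_alphaM iter_alpha_w -iterE alpha_iter.
by rewrite mulgVK.
Qed.

Let shift_trans k x : shift (trans k x) = trans (alpha k) (shift x).
Proof.
by rewrite /shift /trans /=; case: ifP => _ /=; rewrite gmulfM ?mulgA.
Qed.

Let transK k : cancel (trans k) (trans k^-1).
Proof. by case=> l i; rewrite /trans /= mulKg. Qed.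

Let transVK k : cancel (trans k^-1) (trans k).
Proof. by case=> l i; rewrite /trans /= mulVKg. Qed.

Let shiftK : cancel shift (fun x => trans w^-1 (iter p shift x)).
Proof. by move=> x; rewrite -iterSr shift_cycle transK. Qed.

Let shiftVK : cancel (fun x => trans w^-1 (iter p shift x)) shift.
Proof.
by move=> x; rewrite shift_trans gmorphV alpha_w -iterS shift_cycle transK.
Qed.

Lemma cyclic_extension :
  exists (E : groupType) (L : {multiplicative K -> E}) (T : E),
  [/\ injective L, forall k, T * L k = L (alpha k) * T & T ^+ p.+1 = L w].
Proof.
pose L k : bij S := Bij (transK k) (transVK k).
have LM : {morph L : k l / k * l}.
  by move=> k l; apply: bij_eq => x; rewrite bijM /= /trans mulgA.
exists (bij S), (mk_gmorph LM), (Bij shiftK shiftVK); split=> /= [k l|k|].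
(* [L k] sends [(1, ord0)] to [(k, ord0)], which recovers [k]. *)
- by move/(congr1 (fun q : bij S => (q (1, ord0)).1)) => /=; rewrite !mulg1.
- by apply: bij_eq => x; rewrite !bijM /= shift_trans.
- by apply: bij_eq => x; rewrite bijX; apply: shift_cycle.
Qed.

End CyclicExtension.

(* The Reidemeister-Schreier method for a normal subgroup with cyclic quotient
   generated by the class of [t]. *)
Section CyclicQuotient.
Variables (X : Type) (R : relations X) (B : groupType) (s : X -> B).
Hypothesis sP : presents [set: B]%classic s R.
Variables (K : groupType) (f : {multiplicative K -> B}).
Variables (alpha : {multiplicative K -> K}) (w : K) (p : nat).
Variables (t : X) (c : X -> K).
Hypothesis alpha_w : alpha w = w.
Hypothesis alpha_iter : forall k, iter p.+1 alpha k = w * k * w^-1.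
Hypothesis ct : c t = 1.
Hypothesis f_c : forall x, s x = f (c x) * s t.
Hypothesis f_alpha : forall k, s t * f k = f (alpha k) * s t.
Hypothesis f_lcs : forall k, lcs B 2 (f k).
(** Quantified over all [E], so that checking the relations uses only how [T] acts and what its
    power is, not the construction of the extension. *)
Hypothesis ext_rel :
  forall (E : groupType) (L : {multiplicative K -> E}) (T : E),
  (forall k, T * L k = L (alpha k) * T) -> T ^+ p.+1 = L w ->
  satisfies R (fun x => L (c x) * T).
Hypothesis ext_f :
  forall (E : groupType) (L : {multiplicative K -> E})
    (h : {multiplicative B -> E}),
  (forall k, h (s t) * L k = L (alpha k) * h (s t)) -> h (s t) ^+ p.+1 = L w ->
  (forall x, h (s x) = L (c x) * h (s t)) -> forall k, h (f k) = L k.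

Lemma range_subgroup (G H : groupType) (g : {multiplicative G -> H}) :
  is_subgroup (range g).
Proof.
split=> [|_ _ [x _ <-] [y _ <-]|_ [x _ <-]].
- by exists 1; rewrite ?gmorph1.
- by exists (x * y); rewrite ?gmulfM.
- by exists x^-1; rewrite ?gmorphV.
Qed.

(** Conjugation by [s t] acts on the image as [alpha]. Stability under the inverse conjugation needs
    its own argument in an infinite group: [alpha] is inverted by [k |-> w^-1 alpha^p(k) w]. *)
Lemma cyclic_quotient_normal : is_normal (range f).
Proof.
have f_alphaV k : f (w^-1 * iter p alpha k * w) * (s t)^-1 = (s t)^-1 * f k.
  apply: (mulgI (s t)); rewrite mulgA f_alpha !gmulfM gmorphV alpha_w -iterS.
  by rewrite alpha_iter -!gmulfM !gnorm.
(* Both directions of conjugation are recorded, which makes [P] closed under inverses. *)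
pose P := [set x | forall z, (range f z -> range f (x * z * x^-1)) /\
                        (range f z -> range f (x^-1 * z * x))]%classic.
have [R1 RM RV] := range_subgroup f.
have Psub : is_subgroup P.
  split=> [z|x y Px Py z|x Px z]; rewrite /P /mkset ?gnorm //.
  - split=> Rz.
      by have := (Px _).1 ((Py _).1 Rz); rewrite !gnorm.
    by have := (Py _).2 ((Px _).2 Rz); rewrite !gnorm.
  - by split=> Rz; [apply: (Px _).2 | apply: (Px _).1].
suff PB x : P x by move=> x z /(proj1 (PB x z)).
apply: (presents_ind sP Psub) x => x; rewrite f_c.
have [_ PM _] := Psub; apply: PM => z; split=> Rz.
- by apply: (RM); [apply: (RM) => //; exists (c x) | apply: RV; exists (c x)].
- by apply: (RM); [apply: (RM) => //; apply: RV; exists (c x) | exists (c x)].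
- by case: Rz => k _ <-; exists (alpha k) => //; rewrite f_alpha mulgK.
- case: Rz => k _ <-; exists (w^-1 * iter p alpha k * w) => //.
  by rewrite -f_alphaV mulgVK.
Qed.

Lemma cyclic_quotient : injective f /\ range f = lcs B 2.
Proof.
split.
  have [E [L [T [L_inj TL Tp]]]] := cyclic_extension alpha_w alpha_iter.
  have [h hE] := presents_lift sP (ext_rel TL Tp).
  have hT : h (s t) = T by rewrite hE ct gmorph1 mul1g.
  have hf : h \o f =1 L.
    by apply: ext_f; rewrite hT.
  by move=> k l fkl; apply: L_inj; rewrite -!hf /= fkl.
apply/seteqP; split=> [_ [k _ <-] //|].
apply: lcs_min => [|g h _]; first exact: range_subgroup.
apply: (commutative_mod sP) => [||x y]; first exact: range_subgroup.
  exact: cyclic_quotient_normal.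
have [_ RM RV] := range_subgroup f.
have Rn := cyclic_quotient_normal.
(* All generators lie in the coset of [s t] modulo the image of [f], so the quotient by this image
   is cyclic. *)
rewrite f_c [s y]f_c comm_same_coset.
have Rf k : range f (f k) by exists k.
have RC u v : range f u -> range f v -> range f (comm v u).
  by move=> Ru Rv; apply: (RM) => //; [apply: Rn | apply: RV].
apply: (RM); [apply: (Rn) | by apply: RC; apply: Rf].
rewrite -gmorphV -gmulfM.
by apply: (RM); [apply: Rn | apply: RV].
Qed.

End CyclicQuotient.

(** * Relations of the sphere braid groups *)

Section Palindromes.
Variable G : groupType.
Implicit Types (c v : nat -> G) (x t : G).

(* Locked, lest rewriting with the group laws see through it. *)
Definition pal m c : G := locked
  ((\prod_(1 <= i < m) c i) * c m ^+ 2 * \prod_(1 <= i < m) c (m - i)).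

Lemma palE m c : pal m c =
  (\prod_(1 <= i < m) c i) * c m ^+ 2 * \prod_(1 <= i < m) c (m - i).
Proof. by rewrite /pal -lock. Qed.

Lemma pal1 c : pal 1 c = c 1%N ^+ 2.
Proof. by rewrite !palE !big_geq // mul1g mulg1. Qed.

Lemma pal_recl m c : pal m.+2 c = c 1%N * pal m.+1 (fun i => c i.+1) * c 1%N.
Proof.
rewrite !palE big_ltn // big_add1 /= [X in _ * X = _]big_nat_recr //=.
rewrite subSn // subnn !mulgA; congr (_ * _ * _).
by apply: eq_big_nat => i /andP[_ lt_im]; rewrite subSn // ltnW.
Qed.

Lemma eq_pal m c v : (forall i, 1 <= i <= m.+1 -> c i = v i) ->
  pal m.+1 c = pal m.+1 v.
Proof.
move=> cv; rewrite !palE cv ?leqnn //; congr (_ * _ * _).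
  by apply: eq_big_nat => i /andP[i1 im]; rewrite cv // i1 ltnW.
apply: eq_big_nat => i /andP[i1 im].
by rewrite cv // subn_gt0 im leq_subr.
Qed.

Lemma commute_pal m c x : (forall i, 1 <= i <= m.+1 -> commute x (c i)) ->
  commute x (pal m.+1 c).
Proof.
elim: m c => [|m IHm] c xc; first by rewrite pal1; apply/commuteX/xc.
rewrite pal_recl; apply: commuteM; last exact: xc.
by apply: commuteM; [apply: xc | apply: IHm => i /andP[_ im]; apply: xc].
Qed.

(** The palindrome has [2(m+1)] letters, each contributing one [t], and [t] commutes with all of
    them. *)
Lemma pal_mulr m v t : (forall i, 1 <= i <= m.+1 -> commute t (v i)) ->
  pal m.+1 (fun i => v i * t) = pal m.+1 v * t ^+ (2 * m.+1).
Proof.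
elim: m v => [|m IHm] v tv.
  by rewrite !pal1 muln1 expgMn //; apply/commute_sym/tv.
rewrite !pal_recl IHm => [|i /andP[_ im]]; last exact: tv.
have tv1 : commute t (v 1%N) by apply: tv.
have tP : commute t (pal m.+1 (fun i => v i.+1)).
  by apply: commute_pal => i /andP[_ im]; apply: tv.
rewrite [(2 * m.+2)%N]mulnS; move: (2 * m.+1)%N (pal _ _) tP => k P tP.
have tkv : t ^+ k.+1 * v 1%N = v 1%N * t ^+ k.+1.
  by apply/commute_sym/commuteX/commute_sym.
have -> : v 1%N * t * (P * t ^+ k) = v 1%N * P * t ^+ k.+1.
  by rewrite -!mulgA [t * (P * _)]mulgA tP -mulgA -expgS.
by rewrite mulgA -[_ * t ^+ k.+1 * v _]mulgA tkv mulgA -[_ * _ * t]mulgA -expgSr.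
Qed.

(* In terms of braids: the first strand running around all the others commutes
   with the braids on the others. *)
Lemma pal_commute m c :
  (forall i j, 1 <= i <= m.+1 -> 1 <= j <= m.+1 -> i + 2 <= j ->
     commute (c i) (c j)) ->
  (forall i, 1 <= i <= m -> c i * c i.+1 * c i = c i.+1 * c i * c i.+1) ->
  forall j, 2 <= j <= m.+1 -> commute (c j) (pal m.+1 c).
Proof.
elim: m c => [|m IHm] c far braid j; first by case: j => [|[|]].
have IHj : forall j, 2 <= j <= m.+1 ->
    commute (c j.+1) (pal m.+1 (fun i => c i.+1)).
  apply: IHm => [i k ? /andP[_ Hk] Hik|i /andP[_ Hi]]; last exact: braid.
  by apply: far => //; lia.
(* For [j > 2], [c j] commutes with [c 1] and, by induction, with the inner palindrome. For [j = 2]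
   the inner palindrome is written [c 2 Q c 2] with [Q] commuting with [c 1], and the braid relation
   is applied on both sides of [Q]. *)
case: j => [|[|[|j]]] // /andP[_ le_j]; last first.
  rewrite pal_recl; have c1j : commute (c j.+3) (c 1%N) by apply/commute_sym/far.
  by apply: commuteM => //; apply: commuteM => //; apply: (IHj j.+2).
have c121 : c 1%N * c 2%N * c 1%N = c 2%N * c 1%N * c 2%N by apply: braid.
have [Q [c1Q QE]] : exists Q, commute (c 1%N) Q /\
    pal m.+1 (fun i => c i.+1) = c 2%N * Q * c 2%N.
  case: m {le_j IHj IHm} far {braid} => [|m] far.
    by exists 1; split; [apply: commute1 | rewrite pal1 mulg1].
  exists (pal m.+1 (fun i => c i.+2)); split; last by rewrite pal_recl.
  by apply: commute_pal => i /andP[i1 im]; apply: far => //; lia.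
rewrite /commute pal_recl QE !mulgA -c121 -!mulgA; congr (_ * (_ * _)).
by rewrite [c 1%N * (Q * _)]mulgA c1Q -mulgA; congr (_ * _); rewrite !mulgA.
Qed.

End Palindromes.

Lemma gmorph_prod (G H : groupType) (f : {multiplicative G -> H}) I (r : seq I)
    (P : pred I) (F : I -> G) :
  f (\prod_(i <- r | P i) F i) = \prod_(i <- r | P i) f (F i).
Proof. exact: (big_morph f gmulfM (gmorph1 f)). Qed.

Lemma gmorph_pal (G H : groupType) (f : {multiplicative G -> H}) m
    (c : nat -> G) :
  f (pal m c) = pal m (fun i => f (c i)).
Proof. by rewrite !palE !gmulfM !gmorph_prod. Qed.

Section SphereBraidRelations.
Variable n : nat.
Hypothesis n_gt1 : 2 <= n.

Definition sb_eqs (E : groupType) (c : nat -> E) : Prop :=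
  [/\ forall i j, 1 <= i <= n - 1 -> 1 <= j <= n - 1 -> i + 2 <= j ->
        c i * c j = c j * c i,
      forall i, 1 <= i <= n - 2 -> c i * c i.+1 * c i = c i.+1 * c i * c i.+1
    & pal (n - 1) c = 1].

Lemma weval_sb (E : groupType) (c : nat -> E) i : 1 <= i <= n - 1 ->
  weval (fun i : 'I_n.-1 => c i.+1) (sb_gen n i) = c i.
Proof. by rewrite subn1; apply: weval_nth1. Qed.

Lemma satisfies_sphere_braid (E : groupType) (c : nat -> E) :
  satisfies (sphere_braid_rel n) (fun i => c i.+1) <-> sb_eqs c.
Proof.
have evalE : weval (fun i : 'I_n.-1 => c i.+1)
    ((\prod_(1 <= i < n - 1) sb_gen n i) * sb_gen n (n - 1) ^+ 2
         * \prod_(1 <= i < n - 1) sb_gen n (n - 1 - i)) = pal (n - 1) c.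
  rewrite palE !wevalE weval_sb ?leqnn ?subn_gt0 ?andbT //; congr (_ * _ * _).
    by apply: eq_big_nat => i /andP[i1 im]; rewrite weval_sb // i1 ltnW.
  apply: eq_big_nat => i /andP[i1 im].
  by rewrite weval_sb // subn_gt0 im leq_subr.
split=> [Rc | [far braid sphere] _ _ [i j Hi Hj Hij | i Hi |]].
- split=> [i j Hi Hj Hij|i Hi|].
  + have := Rc _ _ (sb_far Hi Hj _); rewrite !wevalE !weval_sb //.
    by apply; rewrite Hij.
  + have Hi' : 1 <= i <= n - 1 /\ 1 <= i.+1 <= n - 1 by lia.
    by have := Rc _ _ (sb_braid Hi); rewrite !wevalE !weval_sb; tauto.
  + by have := Rc _ _ (sb_sphere n); rewrite evalE.
- rewrite !wevalE !weval_sb //.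
  by case/orP: Hij => Hij; [apply: far | symmetry; apply: far].
- have Hi' : 1 <= i <= n - 1 /\ 1 <= i.+1 <= n - 1 by lia.
  by rewrite !wevalE !weval_sb; [apply: braid | tauto | tauto].
- by rewrite evalE.
Qed.

End SphereBraidRelations.

(** * The braid relations rewritten in [T], [U] and [V] *)

Section Extension.
Variable p : nat.

Definition shift_eqs (E : groupType) (T : E) (U V : nat -> E) : Prop :=
  (forall i, T * U i = U i.+1 * T) /\
  (forall i, 1 <= i <= p.+1 -> T * V i = V i * T).

(* The relations of the sphere braid group on [p + 4] strings in terms of
   [T = sigma_1], [U i = sigma_1^i sigma_2 sigma_1^-(i+1)] and
   [V i = sigma_(i+2) sigma_1^-1]. *)
Definition ext_eqs (E : groupType) (T : E) (U V : nat -> E) : Prop :=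
  [/\ forall i j, 1 <= i <= p.+1 -> 1 <= j <= p.+1 -> i + 2 <= j ->
        V i * V j = V j * V i,
      forall i, 1 <= i <= p -> V i * V i.+1 * V i = V i.+1 * V i * V i.+1
    & forall j, 2 <= j <= p.+1 -> U 0%N * V j = V j * U 1%N]
  /\ [/\ U 1%N = U 0%N * U 2%N,
         U 0%N * V 1%N * U 2%N = V 1%N * U 1%N * V 1%N
       & U 1%N * pal p.+1 V * U (2 * p.+2)%N * T ^+ (2 * p.+3) = 1].

Lemma exp_shift (E : groupType) (T : E) (U : nat -> E) :
  (forall i, T * U i = U i.+1 * T) ->
  forall k i, T ^+ k * U i = U (i + k)%N * T ^+ k.
Proof.
move=> TU; elim=> [|k IHk] i; first by rewrite addn0 mul1g mulg1.
by rewrite expgSr -mulgA TU mulgA IHk addSnnS -mulgA.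
Qed.

Definition sgen (E : groupType) (T u : E) (V : nat -> E) i : E :=
  match i with 0 | 1 => T | 2 => u * T | k.+3 => V k.+1 * T end.

Section SphereBraidExtension.
Variables (E : groupType) (T : E) (U V : nat -> E).
Hypothesis TUV : shift_eqs T U V.

Let mvU i x : x * T * U i = x * U i.+1 * T.
Proof. by case: TUV => TU _; rewrite -mulgA TU mulgA. Qed.

Let mvV i x : 1 <= i <= p.+1 -> x * T * V i = x * V i * T.
Proof. by case: TUV => _ TV Hi; rewrite -mulgA TV // mulgA. Qed.

(** Each of the [2(p+3)] letters carries one [T], and all of them are moved to the right. The first
    [U 0] is crossed by one [T]; the second by [2 + 2(p+1) = 2(p+2)]. *)
Lemma pal_sgen : pal p.+3 (sgen T (U 0%N) V) =
  U 1%N * pal p.+1 V * U (2 * p.+2)%N * T ^+ (2 * p.+3).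
Proof.
have [TU TV] := TUV.
have palV : pal p.+1 (fun i => sgen T (U 0%N) V i.+2) =
    pal p.+1 V * T ^+ (2 * p.+1).
  by rewrite -pal_mulr; [apply: eq_pal => -[] | exact: TV].
have TP : T ^+ 2 * pal p.+1 V = pal p.+1 V * T ^+ 2.
  by apply: commute_pal => i Hi; apply/commute_sym/commuteX/commute_sym/TV.
have [E1 E2] : (2 * p.+2 = 2 + 2 * p.+1 /\ 2 * p.+3 = 2 * p.+2 + 2)%N by lia.
rewrite !pal_recl palV /= E2 E1; have := exp_shift TU (2 + 2 * p.+1)%N 0%N.
rewrite add0n !expgnDr; move: (T ^+ (2 * p.+1)) => Tk TkU.
have -> X Y : T * (U 0%N * T * X * Y) * T = U 1%N * T ^+ 2 * X * Y * T.
  by rewrite expg2 !mulgA TU.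
rewrite -[U 1%N * _ * _]mulgA [T ^+ 2 * _]mulgA TP.
have -> X : X * (U 0%N * T) * T = X * U 0%N * T ^+ 2 by rewrite !mulgA.
by rewrite -[_ * U 0%N]mulgA -[_ * T ^+ 2 * Tk]mulgA -[_ * _ * U 0%N]mulgA TkU
  !mulgA.
Qed.

(** Moving every [T] to the right turns each braid relation into the corresponding relation of
    [ext_eqs], times a common power of [T]. The converse below cancels that power. *)
Lemma sb_eqs_of_ext : ext_eqs T U V -> sb_eqs p.+4 (sgen T (U 0%N) V).
Proof.
have [TU TV] := TUV.
move=> [[far braid UV2] [U012 UV1 sphere]].
split=> [[|[|[|i]]] [|[|[|j]]] // Hi Hj Hij|[|[|[|i]]] // Hi|] /=.
- by rewrite mulgA TV //; lia.
- by rewrite !mulgA mvV ?mvU ?UV2 //; lia.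
- by rewrite !mulgA !mvV ?(far i.+1 j.+1) //; lia.
- by rewrite !mulgA TU !mvU U012.
- by rewrite !mulgA !mvV // !mvU !mvV // UV1.
- by rewrite !mulgA !mvV ?(braid i.+1) //; lia.
- exact: (etrans pal_sgen).
Qed.

Lemma ext_of_sb_eqs : sb_eqs p.+4 (sgen T (U 0%N) V) -> ext_eqs T U V.
Proof.
have [TU TV] := TUV.
move=> [far braid sphere]; split; split.
- move=> [|i] [|j] // Hi Hj Hij.
  have := far i.+3 j.+3; rewrite /= !mulgA !mvV //.
  by move=> ij; apply/(mulIg T)/(mulIg T)/ij; lia.
- move=> [|i] // Hi.
  have := braid i.+3; rewrite /= !mulgA !mvV //; try lia.
  by move=> ij; apply/(mulIg T)/(mulIg T)/(mulIg T)/ij; lia.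
- move=> [|j] // Hj.
  have := far 2%N j.+3; rewrite /= !mulgA !mvV ?mvU //; try lia.
  by move=> ij; apply/(mulIg T)/(mulIg T)/ij; lia.
- have := braid 1%N isT; rewrite /= !mulgA TU !mvU.
  by move/mulIg/mulIg/mulIg.
- have := braid 2%N isT; rewrite /= !mulgA !mvV // !mvU !mvV //.
  by move/mulIg/mulIg/mulIg.
- by rewrite -pal_sgen.
Qed.

End SphereBraidExtension.

Section StandardGenerators.
Variables (E : groupType) (s : nat -> E).

(** The element called u_(i+1) in the presentations: indices of [Us] start at 0, while those of [Vs]
    start at 1 as in the presentations. *)
Definition Us i : E := s 1%N ^+ i * s 2%N * s 1%N ^- i.+1.
Definition Vs i : E := s i.+2 * (s 1%N)^-1.

Lemma Us0 : Us 0 = s 2%N * (s 1%N)^-1. Proof. by rewrite /Us mul1g. Qed.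

Lemma sgen_std i : 1 <= i -> sgen (s 1%N) (Us 0) Vs i = s i.
Proof. by case: i => [|[|[|i]]] //= _; rewrite ?Us0 mulgVK. Qed.

Hypothesis sP : sb_eqs p.+4 s.

Lemma std_shift : shift_eqs (s 1%N) Us Vs.
Proof.
split=> [i|[|i] // Hi]; first by rewrite /Us !expgS !invgM !gnorm.
have [far _ _] := sP; rewrite /Vs mulgA mulgVK far ?mulgK //; lia.
Qed.

Lemma std_ext : ext_eqs (s 1%N) Us Vs.
Proof.
apply: (ext_of_sb_eqs std_shift); have [far braid sphere] := sP.
split=> [i j Hi Hj Hij|i Hi|]; try (rewrite !sgen_std; try lia).
- exact: far.
- exact: braid.
- by rewrite -sphere; apply: eq_pal => i /andP[i1 _]; apply: sgen_std.
Qed.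

End StandardGenerators.

End Extension.

(** * A criterion for presenting the commutator subgroup, for four or more strings *)

Section SphereBraidGroup.
Variables (p : nat) (B : groupType) (s : nat -> B).
Hypothesis hB : is_sphere_braid_group p.+4 s.

Lemma sb_group_eqs n (C : groupType) (r : nat -> C) : 2 <= n ->
  is_sphere_braid_group n r -> sb_eqs n r.
Proof. by move=> n2 /presents_satisfies /(satisfies_sphere_braid n2). Qed.

(** The braid relation conjugates each generator into the next one, so the quotient of neighbours is
    a commutator; these quotients telescope. *)
Lemma lcs2_generators n (C : groupType) (r : nat -> C) : 2 <= n ->
  is_sphere_braid_group n r ->
  forall i, i <= n - 2 -> lcs C 2 (r i.+1 * (r 1%N)^-1).
Proof.
move=> n2 /(sb_group_eqs n2)[_ braid _]; have [N1 NM _] := lcs_subgroup C 2.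
elim=> [|i IHi] Hi; first by rewrite mulgV.
have := NM _ _ (lcs2_comm (r i.+1 * r i.+2) (r i.+1)) (IHi (ltnW Hi)).
have -> : comm (r i.+1 * r i.+2) (r i.+1) = r i.+2 * (r i.+1)^-1.
  by rewrite /comm braid ?Hi // !gnorm.
by rewrite !gnorm.
Qed.

Lemma lcs_Us i : lcs B 2 (Us s i).
Proof.
have -> : Us s i = s 1%N ^+ i * (s 2%N * (s 1%N)^-1) * (s 1%N ^+ i)^-1.
  by rewrite /Us expgSr !gnorm.
by apply: lcs_normal; apply: (lcs2_generators (n := p.+4)).
Qed.

Lemma lcs_Vs i : 1 <= i <= p.+1 -> lcs B 2 (Vs s i).
Proof. by move=> Hi; apply: (lcs2_generators (n := p.+4)) => //; lia. Qed.

Variables (Y : Type) (RK : relations Y) (fam : Y -> B).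
Local Notation K := (presented RK).
Variables (alpha : {multiplicative K -> K}) (w u : K) (v : nat -> K).
Let U i := iter i alpha u.
Hypothesis famP : satisfies RK fam.
Hypothesis fam_lcs : forall y, lcs B 2 (fam y).
Hypothesis alpha_w : alpha w = w.
Hypothesis alpha_iter :
  forall y, iter (2 * p.+3) alpha (pgen RK y) = w * pgen RK y * w^-1.
Hypothesis alpha_v : forall i, 1 <= i <= p.+1 -> alpha (v i) = v i.
Hypothesis v_far : forall i j, 1 <= i <= p.+1 -> 1 <= j <= p.+1 -> i + 2 <= j ->
  v i * v j = v j * v i.
Hypothesis v_braid : forall i, 1 <= i <= p ->
  v i * v i.+1 * v i = v i.+1 * v i * v i.+1.
Hypothesis uv_far : forall j, 2 <= j <= p.+1 -> U 0%N * v j = v j * U 1%N.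
Hypothesis u_braid : U 1%N = U 0%N * U 2%N.
Hypothesis uv_braid : U 0%N * v 1%N * U 2%N = v 1%N * U 1%N * v 1%N.
Hypothesis uvw_sphere : U 1%N * pal p.+1 v * U (2 * p.+2)%N * w = 1.
Hypothesis fam_uv : forall f : {multiplicative K -> B},
  (forall y, f (pgen RK y) = fam y) ->
  f u = Us s 0 /\ forall i, 1 <= i <= p.+1 -> f (v i) = Vs s i.
Hypothesis fam_alpha : forall f : {multiplicative K -> B},
  (forall y, f (pgen RK y) = fam y) ->
  forall y, s 1%N * fam y = f (alpha (pgen RK y)) * s 1%N.
Hypothesis fam_lift : forall (E : groupType) (h : {multiplicative B -> E})
    (L : {multiplicative K -> E}),
  h (s 1%N) ^+ (2 * p.+3) = L w -> (forall i, h (Us s i) = L (U i)) ->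
  (forall i, 1 <= i <= p.+1 -> h (Vs s i) = L (v i)) ->
  forall y, h (fam y) = L (pgen RK y).

Let c i : K := match i with 0 | 1 => 1 | 2 => u | k.+3 => v k.+1 end.

Let c_sgen (E : groupType) (L : {multiplicative K -> E}) (T : E) i :
  L (c i) * T = sgen T (L u) (fun i => L (v i)) i.
Proof. by case: i => [|[|[|i]]] //=; rewrite gmorph1 mul1g. Qed.

Let alpha_iterM j : {morph iter j alpha : x y / x * y}.
Proof. by elim: j => // j IHj x y /=; rewrite IHj gmulfM. Qed.

Let alpha_iter_conj k : iter (2 * p.+3) alpha k = w * k * w^-1.
Proof.
have cM : {morph (fun k : K => w * k * w^-1) : x y / x * y}.
  by move=> x y; rewrite !gnorm.
exact: (presented_ext (f := mk_gmorph (@alpha_iterM (2 * p.+3)))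
  (g := mk_gmorph cM) alpha_iter k).
Qed.

(** The common frame for [n = 4], [n = 5] and [n >= 6], with [n = p + 4]: [cyclic_quotient] is
    applied with [t = sigma_1] and exponent [2n - 2 = 2(p+3)], and the braid relations in the
    extension come from those of [u], [v] and [w] in [K]. Each case then supplies [K], [alpha] and
    [w]. *)
Lemma presents_lcs2 : presents (lcs B 2) fam RK.
Proof.
have [f f_fam] := presented_lift famP; have [fu fv] := fam_uv f_fam.
suff [f_inj f_range] : injective f /\ range f = lcs B 2 by exists f.
have mE : (2 * p.+3 = (2 * p.+3).-1.+1)%N by lia.
have sP := sb_group_eqs (n := p.+4) isT hB.
have alphaX := alpha_iter_conj; rewrite mE in alphaX.
apply: (cyclic_quotient hB (t := ord0) (c := fun x => c x.+1) alpha_w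
  alphaX) => //=.
- case=> [[|[|i]] lti] /=; rewrite ?gmorph1 ?mul1g //.
    by rewrite fu Us0 mulgVK.
  by rewrite fv ?mulgVK //; lia.
- move=> k; apply/(mulIg (s 1%N)^-1); rewrite mulgK; move: k.
  have cM : {morph (fun x : B => s 1%N * x * (s 1%N)^-1) : x y / x * y}.
    by move=> x y; rewrite !gnorm.
  apply: (@presented_ext _ _ _ (mk_gmorph cM \o f) (f \o alpha)) => y /=.
  by rewrite f_fam (fam_alpha f_fam) mulgK.
- apply: (presented_ind (P := fun k => lcs B 2 (f k))) => [|y]; last first.
    by rewrite f_fam.
  have [N1 NM NV] := lcs_subgroup B 2.
  split=> [|x y|x]; rewrite ?gmorph1 // ?gmulfM ?gmorphV; first exact: NM.
  exact: NV.
- move=> E L T TL Tm; rewrite (funext (fun x : 'I_p.+3 => c_sgen L T x.+1)).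
  apply/(@satisfies_sphere_braid p.+4) => //.
  apply: (sb_eqs_of_ext (U := fun i => L (U i)) (V := fun i => L (v i))).
    by split=> i *; rewrite TL ?alpha_v.
  split; split; rewrite -?gmulfM //.
  - by move=> i j Hi Hj Hij; rewrite -!gmulfM v_far.
  - by move=> i Hi; rewrite -!gmulfM v_braid.
  - by move=> j Hj; rewrite -!gmulfM uv_far.
  - by rewrite -u_braid.
  - by rewrite uv_braid.
  - by rewrite mE Tm -(gmorph_pal L) -!gmulfM uvw_sphere gmorph1.
- move=> E L h hL hm hs.
  have hi i : 1 <= i <= p.+3 -> h (s i) = L (c i) * h (s 1%N).
    by case: i => // i /= Hi; apply: (hs (Ordinal (n := p.+3) (m := i) _)).
  apply: (@presented_ext _ _ _ (h \o f)) => y /=; rewrite f_fam; apply: fam_lift.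
  + by rewrite mE.
  + elim=> [|i IHi]; first by rewrite Us0 gmulfM gmorphV hi // mulgK.
    have [sU _] := std_shift sP.
    apply: (mulIg (h (s 1%N))); rewrite -gmulfM -sU gmulfM IHi hL //.
  + move=> i Hi; rewrite gmulfM gmorphV hi; last lia.
    by case: i Hi => // i Hi; rewrite mulgK.
Qed.
End SphereBraidGroup.

(** * Six or more strings *)

Section FibonacciSequences.
Variable G : groupType.
Implicit Types (U V : nat -> G) (x y z g : G).

Definition fib_rec U := forall i, U i.+2 = (U i)^-1 * U i.+1.

Fixpoint fibseq x y i : G := if i is j.+1 then fibseq y (x^-1 * y) j else x.

Lemma fibseq_rec x y : fib_rec (fibseq x y).
Proof. by move=> i; elim: i x y => //= i IHi x y; apply: IHi. Qed.

Lemma fibseq_uniq U : fib_rec U -> U =1 fibseq (U 0%N) (U 1%N).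
Proof.
move=> UE i; suff: U i = fibseq (U 0%N) (U 1%N) i /\
  U i.+1 = fibseq (U 0%N) (U 1%N) i.+1 by case.
by elim: i => // i [IHi IHi1]; split=> //; rewrite UE IHi IHi1 -fibseq_rec.
Qed.

(** Both conjugation by [g] and an index shift preserve the recursion, so two consecutive values
    suffice. *)
Lemma fib_conj U g j : fib_rec U ->
  g * U 0%N = U j * g -> g * U 1%N = U j.+1 * g ->
  forall i, g * U i = U (i + j)%N * g.
Proof.
move=> UE g0 g1 i; suff: g * U i = U (i + j)%N * g /\
  g * U i.+1 = U (i.+1 + j)%N * g by case.
elim: i => // i [IHi IHi1]; split=> //.
have gV : g * (U i)^-1 = (U (i + j)%N)^-1 * g.
  by apply: (mulIg (U i)); rewrite mulgVK -mulgA IHi mulKg.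
by rewrite UE mulgA gV -mulgA IHi1 mulgA UE.
Qed.

Definition fib_y x y : G := y^-1 * x * y * x^-1.

Lemma fib_y_shift U : fib_rec U ->
  forall i, fib_y (U i) (U i.+1) = fib_y (U 0%N) (U 1%N).
Proof.
move=> UE; elim=> // i <-; rewrite /fib_y UE !gnorm //.
Qed.

(** Since [y] may be computed at index [i], this is an identity in the free group on [U i] and
    [U i.+1]. *)
Lemma fib_period U : fib_rec U ->
  forall i, fib_y (U 0%N) (U 1%N) * U i = U (i + 6)%N * fib_y (U 0%N) (U 1%N).
Proof.
by move=> UE i; rewrite -(fib_y_shift UE i) !addnS addn0 !UE /fib_y !gnorm.
Qed.

End FibonacciSequences.

Lemma triple_move (E : groupType) (x a y z : E) :
  x * a * y * a^-1 * z^-1 * a^-1 = 1 <-> x * a * y = a * z * a.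
Proof.
split=> H; last by rewrite H !gnorm.
by have := congr1 (fun u => u * a * z * a) H; rewrite !gnorm.
Qed.

Section SixOrMoreStrings.
Variable p : nat.

Section Relations.
Variables (E : groupType) (U v : nat -> E).
Local Notation y := (fib_y (U 0%N) (U 1%N)).
Local Notation A := (pal p.+1 v).

(* [U i] stands for u_(i+1); the pairs of relations for [2n - 2 = 6k + r] all say
   that the conjugation by [A y^k] shifts the indices of the [U i] by [6 - r]. *)
Definition eqs6 : Prop :=
  [/\ forall i j, 1 <= i <= p.+1 -> 1 <= j <= p.+1 -> i + 2 <= j ->
        v i * v j = v j * v i,
      forall i, 1 <= i <= p -> v i * v i.+1 * v i = v i.+1 * v i * v i.+1
    & A * y^-1 * v 1%N = v 1%N * (A * y^-1)]
  /\ [/\ forall j, 2 <= j <= p.+1 ->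
          U 0%N * v j = v j * U 1%N /\ U 1%N * v j = v j * U 2%N,
         U 0%N * v 1%N * U 2%N = v 1%N * U 1%N * v 1%N
       & forall k r : nat, r = 2 \/ r = 4%N \/ r = 6%N ->
          (2 * p.+3 = 6 * k + r)%N ->
          A * y ^+ k * U 0%N = U (6 - r)%N * (A * y ^+ k) /\
          A * y ^+ k * U 1%N = U (7 - r)%N * (A * y ^+ k)].

Definition gen6 (x : gens6 p.+4) : E :=
  match x with G6_u1 => U 0%N | G6_u2 => U 1%N | G6_v i => v i.+1 end.

Lemma weval_v6 i : 1 <= i <= p.+1 -> weval gen6 (v6 p.+4 i) = v i.
Proof. exact: (weval_nth1 (m := p.+1)). Qed.

Lemma weval_A6 : weval gen6 (A6 p.+4) = A.
Proof.
have -> : A6 p.+4 = (\prod_(1 <= i < p.+1) v6 p.+4 i) * v6 p.+4 p.+1 ^+ 2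
    * \prod_(1 <= i < p.+1) v6 p.+4 (p.+1 - i) by [].
rewrite palE !wevalE weval_v6 ?leqnn //; congr (_ * _ * _).
  by apply: eq_big_nat => i Hi; rewrite weval_v6 //; lia.
by apply: eq_big_nat => i Hi; rewrite weval_v6 //; lia.
Qed.

Lemma weval_y6 : weval gen6 (y6 p.+4) = y. Proof. by []. Qed.

Lemma conj_move (q a x z : E) :
  q * x * q^-1 = a^-1 * z * a <-> a * q * x = z * (a * q).
Proof.
split=> [qx|aq]; last by apply: (mulgI a); rewrite !mulgA aq !gnorm.
by have := congr1 (fun u => a * u * q) qx; rewrite !gnorm.
Qed.

Lemma fib_conj_move (a x y : E) :
  a * y * a^-1 = x /\ a * x * a^-1 = x * y^-1 <->
  x * a = a * y /\ y * a = a * (x^-1 * y).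
Proof.
have VE u z : (a * u * a^-1 = z) <-> (a * u^-1 * a^-1 = z^-1).
  by split=> [<-|/(congr1 inv)]; rewrite !gnorm.
split=> [[ay ax]|[ay ax]].
  have xa : x * a = a * y by rewrite -ay !gnorm.
  move/VE: ax => ax; split=> //; rewrite !mulgA -[a * x^-1](mulgVK a) ax.
  by rewrite -mulgA -xa !gnorm.
split; first by rewrite -ay !gnorm.
by apply/VE/(mulIg (x * a)); rewrite !gnorm -[LHS]mulgA ay ax !gnorm.
Qed.

Lemma satisfies6 : fib_rec U -> satisfies (rel6 p.+4) gen6 <-> eqs6.
Proof.
move=> UE.
have nE : (2 * p.+4 - 2 = 2 * p.+3)%N by lia.
(* These are the words on the right-hand sides of the last relations of [rel6]: [U 2] and [U 3] for
   [r = 4], [U 4] and [U 5] for [r = 2]. *)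
have U2 : U 2%N = (U 0%N)^-1 * U 1%N by rewrite UE.
have U3 : U 3%N = (U 1%N)^-1 * (U 0%N)^-1 * U 1%N by rewrite !UE !gnorm.
have U4 : U 4%N = (U 1%N)^-1 * y^-1 by rewrite !UE /fib_y !gnorm.
have U5 : U 5%N = (U 1%N)^-1 * U 0%N * y^-1 by rewrite !UE /fib_y !gnorm.
have eqs6E := (weval_A6, weval_y6, @wevalE).
split=> [Rg|[[far braid Ayv] [uv uvb cyc]] a b].
  split; split.
  - move=> i j Hi Hj Hij; have := Rg _ _ (rel6_far (n := p.+4) Hi Hj _).
    by rewrite !wevalE !weval_v6 // => -> //; rewrite Hij.
  - move=> i Hi; have Hi4 : 1 <= i <= p.+4 - 4 by lia.
    have := Rg _ _ (rel6_braid Hi4).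
    by rewrite !wevalE !weval_v6 //; lia.
  - have := Rg _ _ (rel6_Ayv _).
    by rewrite !eqs6E !weval_v6.
  - move=> j Hj; have := Rg _ _ (rel6_vu1 (n := p.+4) Hj).
    have := Rg _ _ (rel6_vu2 (n := p.+4) Hj).
    rewrite !wevalE !weval_v6 => [vu2 vu1|]; last lia.
    by rewrite U2; apply/fib_conj_move.
  - have := Rg _ _ (rel6_uv _); rewrite !wevalE !weval_v6 // U2 /=.
    by rewrite -[_ * (U 0%N)^-1 * _]mulgA => /triple_move.
  - move=> k _ [->|[->|->]] Hk; rewrite [(6 - _)%N]/= [(7 - _)%N]/=.
    + have := Rg _ _ (rel6_2u1 (etrans nE Hk)).
      have := Rg _ _ (rel6_2u2 (etrans nE Hk)).
      rewrite !eqs6E => r1 r0.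
      by split; apply/conj_move; rewrite ?U4 ?U5 !mulgA.
    + have := Rg _ _ (rel6_4u1 (etrans nE Hk)).
      have := Rg _ _ (rel6_4u2 (etrans nE Hk)).
      rewrite !eqs6E => r1 r0.
      by split; apply/conj_move; rewrite ?U2 ?U3 !mulgA.
    + have := Rg _ _ (rel6_6u1 (etrans nE Hk)).
      have := Rg _ _ (rel6_6u2 (etrans nE Hk)).
      by rewrite !eqs6E.
case=> {a b} [i j Hi Hj Hij|i Hi||j Hj|j Hj||k Hk|k Hk|k Hk|k Hk|k Hk|k Hk].
- rewrite !wevalE !weval_v6 //.
  by case/orP: Hij => Hij; [apply: far | symmetry; apply: far].
- by rewrite !wevalE !weval_v6 ?braid //; lia.
- by rewrite !eqs6E !weval_v6.
- rewrite !wevalE !weval_v6 /=; last lia.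
  by have := uv j Hj; rewrite U2 => /fib_conj_move[].
- rewrite !wevalE !weval_v6 /=; last lia.
  by have := uv j Hj; rewrite U2 => /fib_conj_move[].
- rewrite !wevalE !weval_v6 //=.
  by rewrite -[_ * (U 0%N)^-1 * _]mulgA; apply/triple_move; rewrite -U2.
all: rewrite nE in Hk.
- have [] := cyc _ 6%N (or_intror (or_intror erefl)) Hk.
  by rewrite !eqs6E.
- have [] := cyc _ 6%N (or_intror (or_intror erefl)) Hk.
  by rewrite !eqs6E.
- have [] := cyc _ 2%N (or_introl erefl) Hk.
  rewrite U4 => /conj_move r0 _.
  by rewrite !eqs6E /= r0 !mulgA.
- have [] := cyc _ 2%N (or_introl erefl) Hk.
  rewrite U5 => _ /conj_move r0.
  by rewrite !eqs6E /= r0 !mulgA.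
- have [] := cyc _ 4%N (or_intror (or_introl erefl)) Hk.
  rewrite U2 => /conj_move r0 _.
  by rewrite !eqs6E /= r0 !mulgA.
- have [] := cyc _ 4%N (or_intror (or_introl erefl)) Hk.
  rewrite U3 => _ /conj_move r0.
  by rewrite !eqs6E /= r0 !mulgA.
Qed.

End Relations.
End SixOrMoreStrings.

Section FibonacciConjugation.
Variables (E : groupType) (U : nat -> E).
Hypothesis UE : fib_rec U.
Local Notation y := (fib_y (U 0%N) (U 1%N)).

(** Conjugation by [g] takes [y] computed at index [i] to [y] computed at index [j], which is the
    same element. *)
Lemma commute_fib_y (g : E) i j :
  (forall k, g * U (i + k)%N = U (j + k)%N * g) -> commute g y.
Proof.
move=> gU; have gV k : g * (U (i + k)%N)^-1 = (U (j + k)%N)^-1 * g.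
  by apply: (mulIg (U (i + k)%N)); rewrite mulgVK -mulgA gU mulKg.
have := gU 1%N; have := gU 0%N; have := gV 0%N; have := gV 1%N.
rewrite !addn0 !addn1 /commute => gV1 gV0 g0 g1.
rewrite -{1}(fib_y_shift UE i) -(fib_y_shift UE j) /fib_y.
by rewrite !mulgA gV1 -[_ * g * U i]mulgA g0 !mulgA -[_ * g * U i.+1]mulgA g1
  !mulgA -[_ * g * _]mulgA gV0 !mulgA.
Qed.

Lemma exp_fib_y k i : y ^+ k * U i = U (i + 6 * k)%N * y ^+ k.
Proof.
elim: k i => [|k IHk] i; first by rewrite mul1g mulg1 muln0 addn0.
by rewrite expgSr -mulgA fib_period // mulgA IHk -mulgA mulnS addnA.
Qed.

Lemma gmorph_fib_y (F : groupType) (f : {multiplicative E -> F}) (a b : E) :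
  f (fib_y a b) = fib_y (f a) (f b).
Proof. by rewrite /fib_y !gmulfM !gmorphV. Qed.

End FibonacciConjugation.

Section SixOrMoreStringsTheory.
Variables (p : nat) (E : groupType) (U v : nat -> E).
Hypothesis UE : fib_rec U.
Local Notation y := (fib_y (U 0%N) (U 1%N)).
Local Notation A := (pal p.+1 v).
Hypothesis rels : eqs6 p U v.

Let cycE k r : (r = 2 \/ r = 4%N \/ r = 6%N) -> (2 * p.+3 = 6 * k + r)%N ->
  forall i, A * y ^+ k * U i = U (i + (6 - r))%N * (A * y ^+ k).
Proof.
move=> Hr Hk; have [_ [_ _ cyc]] := rels.
have [c0 c1] := cyc k r Hr Hk; apply: fib_conj => //.
by rewrite c1; congr (U _ * _); case: Hr => [->|[->|->]].
Qed.

Let eqs6_case :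
  exists k r, (r = 2 \/ r = 4%N \/ r = 6%N) /\ (2 * p.+3 = 6 * k + r)%N.
Proof.
(* Writing [p + 2 = 3k + r'] with [r' < 3] gives [2(p+3) = 6k + 2(r'+1)]. *)
have [k [r [Hr Hk]]] : exists k r, (r < 3)%N /\ p.+2 = (3 * k + r)%N.
  by exists (p.+2 %/ 3)%N, (p.+2 %% 3)%N; split; [rewrite ltn_mod | lia].
exists k, (2 * r.+1)%N; split; last lia.
by case: r Hr {Hk} => [|[|[|]]] // _; [left | right; left | right; right].
Qed.

Let commute_Ay : commute A y.
Proof.
have [k [r [Hr Hk]]] := eqs6_case.
have yAk : commute (A * y ^+ k) y.
  apply: (commute_fib_y UE (i := 0) (j := 6 - r)) => i.
  by rewrite add0n (cycE Hr Hk) addnC.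
apply: (mulIg (y ^+ k)); rewrite -mulgA (commuteX k (commute_refl y)).
by rewrite mulgA yAk mulgA.
Qed.

(** [A y^k] shifts indices by [6 - r] and [y] by 6, so [y A^-1] shifts them by [6k + r = 2(p+3)]. As
    [A^-1] may lower indices, this is first shown from index 6 on, and then pulled back along [y],
    which commutes with [w]. *)
Lemma w_shift6 i : y * A^-1 * U i = U (i + 2 * p.+3)%N * (y * A^-1).
Proof.
have [k [r [Hr Hk]]] := eqs6_case.
have AV j : A^-1 * U (j + (6 - r))%N = U (j + 6 * k)%N * A^-1.
  apply: (mulIg (A * y ^+ k)); rewrite -!mulgA mulKg -exp_fib_y //.
  by rewrite -(cycE Hr Hk) !mulgA mulVg mul1g.
have wy : commute y (y * A^-1).
  by apply: commuteM => //; apply/commuteV/commute_sym.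
have w6 j : y * A^-1 * U (j + 6)%N = U (j + 6 + 2 * p.+3)%N * (y * A^-1).
  have -> : (j + 6 = j + r + (6 - r))%N by case: Hr => [|[|]]; lia.
  rewrite -mulgA AV mulgA fib_period // -mulgA; congr (U _ * _).
  by case: Hr => [|[|]]; lia.
move: (y * A^-1) wy w6 => w wy w6.
apply: (mulgI y); rewrite mulgA wy -mulgA fib_period // mulgA w6.
by rewrite [in RHS]mulgA fib_period // addnAC -[LHS]mulgA -[RHS]mulgA wy.
Qed.

Lemma vU_shift j : 2 <= j <= p.+1 -> forall i, U i * v j = v j * U i.+1.
Proof.
move=> Hj i; have [_ [uv _ _]] := rels; have [uv0 uv1] := uv j Hj.
apply: (mulgI (v j)^-1); rewrite mulKg mulgA.
rewrite (fib_conj (g := (v j)^-1) (j := 1) UE) ?addn1 ?mulgVK //.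
  by apply: (mulIg (v j)); rewrite mulgVK -mulgA uv0 mulKg.
by apply: (mulIg (v j)); rewrite mulgVK -mulgA uv1 mulKg.
Qed.

(** For [j = 1] this is a defining relation. For [j >= 2], [v j] commutes with [y] because it shifts
    the sequence, and with [A] by [pal_commute]. *)
Lemma commute_wv j : 1 <= j <= p.+1 -> commute (y * A^-1) (v j).
Proof.
have [[far braid Ayv] _] := rels.
case: j => [|[|j]] // Hj.
  have -> : y * A^-1 = (A * y^-1)^-1 by rewrite invgM invgK.
  exact/commute_sym/commuteV/commute_sym.
apply/commute_sym/commuteM.
  rewrite -[v _]invgK; apply/commute_sym/commuteV/commute_sym.
  apply: (commute_fib_y UE (i := 0) (j := 1)) => k.
  by apply: (mulgI (v j.+2)); rewrite mulVKg mulgA -vU_shift // mulgK.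
by apply/commuteV/pal_commute => //; lia.
Qed.

(** Makes the shift an endomorphism of [K]. The delicate relation is the one between [U] and [v 1]:
    it is conjugated by [v 3], which shifts [U] and commutes with [v 1]. The existence of [v 3] is
    where [n >= 6] enters. *)
Lemma eqs6_shift : 2 <= p -> eqs6 p (fun i => U i.+1) v.
Proof.
move=> p2; have [[far braid Ayv] [uv uvb _]] := rels.
rewrite /eqs6 (fib_y_shift UE 1); split; split=> //.
- by move=> j Hj; rewrite !vU_shift.
- have v3 : 2 <= 3 <= p.+1 by [].
  have v13 : v 1%N * v 3%N = v 3%N * v 1%N by apply: far.
  apply: (mulgI (v 3%N)); rewrite !mulgA -vU_shift // -[U 0%N * _ * _]mulgA -v13.
  rewrite mulgA -[_ * v 3%N * U _]mulgA -vU_shift // mulgA uvb.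
  rewrite -[LHS]mulgA [in LHS]v13 mulgA -[_ * U 1%N * v 3%N]mulgA.
  by rewrite vU_shift // mulgA.
- move=> k r Hr Hk; rewrite !(cycE Hr Hk); split=> //.
  by congr (U _ * _); case: Hr => [|[|]]; lia.
Qed.

(** Since [w = y A^-1] shifts by [2(p+3)], moving it left past [U (2 * p.+2)] leaves
    [U 0 (U 1)^-1 (U 0)^-1], the recursion continued back to index -2. As [A w = y], an identity in
    [U 0] and [U 1] remains. *)
Lemma eqs6_sphere : U 1%N * A * U (2 * p.+2)%N * (y * A^-1) = 1.
Proof.
have := w_shift6 0; have := w_shift6 1.
have -> : (1 + 2 * p.+3 = (2 * p.+2).+3)%N by lia.
have -> : (0 + 2 * p.+3 = (2 * p.+2).+2)%N by lia.
have : A * (y * A^-1) = y by rewrite mulgA commute_Ay mulgK.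
move: (2 * p.+2)%N (y * A^-1) => q w Aw w1 w0.
have wU : w * (U 0%N * (U 1%N)^-1 * (U 0%N)^-1) = U q * w.
  apply: (mulIg w^-1); rewrite mulgK.
  have -> : U q = U q.+2 * (U q.+3)^-1 * (U q.+2)^-1 by rewrite !UE !gnorm.
  have -> : U q.+2 = w * U 0%N * w^-1 by rewrite w0 mulgK.
  have -> : U q.+3 = w * U 1%N * w^-1 by rewrite w1 mulgK.
  by rewrite !gnorm.
by rewrite -mulgA -wU mulgA -[_ * A * w]mulgA Aw /fib_y !gnorm.
Qed.

End SixOrMoreStringsTheory.

(** The sphere relation amounts to [T^m A = y] with [m = 2n - 2]. As [T^m] shifts indices by [m] and
    [y] by 6, [A y^k] shifts them by [6 - r] when [m = 6k + r]; and [A y^-1 = T^-m] commutes with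
    [V 1]. *)
Lemma eqs6_of_ext p (E : groupType) (T : E) (U V : nat -> E) :
  fib_rec U -> shift_eqs p T U V -> ext_eqs p T U V -> eqs6 p U V.
Proof.
move=> UE [TU TV] [[far braid uv] [_ uvb sphere]].
set y := fib_y (U 0%N) (U 1%N); set m := (2 * p.+3)%N.
have UV i j : 2 <= j <= p.+1 -> U i * V j = V j * U i.+1.
  move=> Hj; elim: i => [|i IHi]; first exact: uv.
  apply: (mulIg T); rewrite -mulgA -TV; last lia.
  by rewrite mulgA -TU -mulgA IHi mulgA TV -?mulgA ?TU //; lia.
have yE : T ^+ m * pal p.+1 V = y.
  have TA k : T ^+ k * pal p.+1 V = pal p.+1 V * T ^+ k.
    by apply: commute_pal => i Hi; apply/commute_sym/commuteX/commute_sym/TV.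
  have mE : m = (2 * p.+2 + 2)%N by rewrite /m; lia.
  have Tq := exp_shift TU (2 * p.+2) 0; have T2 := exp_shift TU 2 1.
  rewrite add0n in Tq; rewrite -/m mE expgnDr in sphere.
  rewrite mE addnC expgnDr -mulgA TA; move: (pal _ _) sphere => A.
  rewrite mulgA -[_ * U _ * _]mulgA -Tq.
  move: (T ^+ 2) (T ^+ (2 * p.+2)) T2 => T2 Tq' T2U H.
  have -> : A * Tq' = (U 1%N)^-1 * T2^-1 * (U 0%N)^-1.
    have := congr1 (fun x => (U 1%N)^-1 * x * T2^-1 * (U 0%N)^-1) H.
    by rewrite !gnorm.
  have -> : T2 * ((U 1%N)^-1 * T2^-1 * (U 0%N)^-1) = (U 3%N)^-1 * (U 0%N)^-1.
    by have -> : U 3%N = T2 * U 1%N * T2^-1; [rewrite T2U mulgK | rewrite !gnorm].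
  by rewrite /y /fib_y !UE !gnorm.
split; split=> //.
- have -> : pal p.+1 V * y^-1 = (T ^+ m)^-1 by rewrite -yE invgM mulVKg.
  apply/commute_sym/commuteV/commute_sym; rewrite /commute.
  by apply/commute_sym/commuteX/commute_sym; rewrite /commute TV.
- by move=> j Hj; rewrite !UV.
- move=> k r Hr Hk.
  suff cyc i : pal p.+1 V * y ^+ k * U i =
      U (i + (6 - r))%N * (pal p.+1 V * y ^+ k).
    by rewrite !cyc; split=> //; congr (U _ * _); case: Hr => [|[|]]; lia.
  rewrite -mulgA exp_fib_y // !mulgA; congr (_ * _).
  apply: (mulgI (T ^+ m)); rewrite !mulgA yE fib_period // exp_shift //.
  rewrite -mulgA yE; congr (U _ * _); rewrite /m; case: Hr => [|[|]]; lia.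
Qed.

Lemma std_fib p (E : groupType) (s : nat -> E) : sb_eqs p.+4 s -> fib_rec (Us s).
Proof.
move=> sP; have [TU _] := std_shift sP; have [_ [U1 _ _]] := std_ext sP.
suff UE i : Us s i.+1 = Us s i * Us s i.+2 by move=> i; rewrite (UE i) mulKg.
elim: i => // i IHi; apply: (mulIg (s 1%N)).
by rewrite -TU [in LHS]IHi mulgA TU -mulgA TU mulgA.
Qed.

Lemma presents6 p (B : groupType) (s : nat -> B) : 2 <= p ->
  is_sphere_braid_group p.+4 s ->
  presents (lcs B 2) (family6 (n := p.+4) s) (rel6 p.+4).
Proof.
move=> p2 hB; set K : groupType := presented (rel6 p.+4).
pose u1 : K := pgen _ (@G6_u1 p.+4); pose u2 : K := pgen _ (@G6_u2 p.+4).
pose v i : K := nth1 (fun j : 'I_(p.+4 - 3) => pgen (rel6 p.+4) (G6_v j)) i.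
pose U := fibseq u1 u2; have UE : fib_rec U := fibseq_rec u1 u2.
have vE (j : 'I_(p.+4 - 3)) : v j.+1 = pgen (rel6 p.+4) (G6_v j).
  rewrite /v /nth1 insubT //= => H; congr (pgen _ (G6_v _)); exact: val_inj.
have KE : gen6 U v = pgen (rel6 p.+4).
  by apply/funext => -[||j] //; apply: vE.
have rels : eqs6 p U v.
  by apply/satisfies6 => //; rewrite KE; apply: satisfies_pgen.
(* [alpha] models conjugation by [sigma_1]: it shifts the [U i] and fixes the [v i]. *)
have [alpha alphaE] : exists alpha : {multiplicative K -> K},
    forall x, alpha (pgen _ x) = gen6 (fun i => U i.+1) v x.
  apply/presented_lift/satisfies6; first by move=> i; apply: UE.
  exact: eqs6_shift.
have alphaU i : alpha (U i) = U i.+1.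
  suff: alpha (U i) = U i.+1 /\ alpha (U i.+1) = U i.+2 by case.
  elim: i => [|i [IHi IHi1]].
    by split; [apply: (alphaE G6_u1) | apply: (alphaE G6_u2)].
  by split=> //; rewrite UE gmulfM gmorphV IHi IHi1 -UE.
have alphav i : 1 <= i <= p.+1 -> alpha (v i) = v i.
  case: i => // i Hi; pose j := Ordinal (n := p.+4 - 3) (m := i) Hi.
  by rewrite (vE j) alphaE; apply: (vE j).
have iterU j i : iter j alpha (U i) = U (i + j)%N.
  by elim: j => [|j IHj]; rewrite ?addn0 // addnS iterS IHj alphaU.
have sP := sb_group_eqs (n := p.+4) isT hB.
have famE : family6 (n := p.+4) s = gen6 (Us s) (Vs s).
  by apply/funext => -[||j] //=; rewrite Us0.
(* The word that the sphere relation equates with [sigma_1^(2n-2)]. *)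
pose w : K := fib_y u1 u2 * (pal p.+1 v)^-1.
have [[far braid _] [uv uvb _]] := rels.
have [sU sV] := std_shift sP.
apply: (presents_lcs2 hB (alpha := alpha) (w := w) (u := u1) (v := v)).
- rewrite famE; apply/satisfies6; first exact: (std_fib sP).
  by apply: (eqs6_of_ext (std_fib sP) (std_shift sP) (std_ext sP)).
- rewrite famE => -[||j] /=; [exact: (lcs_Us hB) | exact: (lcs_Us hB) |].
  by apply: (lcs_Vs hB); rewrite -ltnS ltn_ord.
- rewrite gmulfM gmorphV gmorph_fib_y gmorph_pal (alphaU 0%N) (alphaU 1%N).
  rewrite (fib_y_shift UE 1); congr (_ * _^-1); exact: eq_pal.
- rewrite -KE => -[||j].
  + by rewrite -[gen6 _ _ _]/(U 0%N) iterU (w_shift6 UE rels) mulgK.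
  + by rewrite -[gen6 _ _ _]/(U 1%N) iterU (w_shift6 UE rels) mulgK.
  + have Hj : 1 <= j.+1 <= p.+1 by rewrite /= ltn_ord.
    have wv : w * v j.+1 = v j.+1 * w := commute_wv UE rels Hj.
    rewrite -[gen6 _ _ _]/(v j.+1) wv mulgK; apply: iter_fix; exact: alphav.
- exact: alphav.
- exact: far.
- exact: braid.
- by move=> j Hj; rewrite !(iterU _ 0%N); case: (uv j Hj).
- by rewrite !(iterU _ 0%N) UE mulVKg.
- by rewrite !(iterU _ 0%N).
- by rewrite !(iterU _ 0%N); apply: eqs6_sphere.
- move=> f; rewrite famE => fE; split; first exact: (fE (G6_u1)).
  move=> [|i] // Hi; have := fE (G6_v (Ordinal (n := p.+4 - 3) (m := i) Hi)).
  by rewrite -vE.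
- move=> f; rewrite famE => fE x; rewrite alphaE; case: x => [||j]; rewrite /gen6.
  + by rewrite (fE G6_u2) sU.
  + by rewrite gmulfM gmorphV (fE G6_u1) (fE G6_u2) sU (std_fib sP).
  + have -> : f (v j.+1) = Vs s j.+1 by rewrite vE fE.
    by apply: sV; rewrite /= ltn_ord.
- move=> F h L _ hU hV; rewrite famE => -[||j]; rewrite /gen6.
  + exact: hU 0%N.
  + by rewrite (hU 1%N); apply/congr1/(alphaU 0%N).
  + by rewrite hV ?vE //= ltn_ord.
Qed.

(** * Five strings *)

Section FiveStringsRelations.
Variables (E : groupType) (w : E) (U v : nat -> E).

(** [U i] stands for u_(i+1), and the recursion extends it beyond the eight generators. The
    relations that mix [w] with the ends of the list say that [w] shifts indices by 8. *)
Definition eqs5 : Prop :=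
  [/\ v 1%N * v 2%N * v 1%N = v 2%N * v 1%N * v 2%N,
      forall i, 1 <= i <= 2 -> w * v i = v i * w
    & U 0%N * v 2%N = v 2%N * U 1%N /\ U 1%N * v 2%N = v 2%N * U 2%N]
  /\ [/\ forall i, i <= 7 -> U i * v 1%N * U i.+2 = v 1%N * U i.+1 * v 1%N,
         w * U 0%N = U 8%N * w, w * U 1%N = U 9%N * w
       & U 1%N * (v 1%N * v 2%N ^+ 2 * v 1%N) * U 6%N * w = 1].

Definition gen5 (x : gens5) : E :=
  match x with G5_w => w | G5_u i => U i | G5_v i => v i.+1 end.

Lemma weval_u5 i : 1 <= i <= 8 -> weval gen5 (u5 i) = U i.-1.
Proof. exact: (weval_nth1 (c := fun i => U i.-1)). Qed.

Lemma weval_v5 i : 1 <= i <= 2 -> weval gen5 (v5 i) = v i.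
Proof. exact: weval_nth1. Qed.

Lemma triple_move_conj (x a y z g : E) : g * a = a * g ->
  x * a * g * y * a^-1 * z^-1 * g^-1 * a^-1 = 1 <->
  x * a * (g * y * g^-1) = a * (g * z * g^-1) * a.
Proof.
move=> ga; have gVa : g^-1 * a = a * g^-1 by apply/commute_sym/commuteV/commute_sym.
split=> H.
  have := congr1 (fun u => u * a * g * z * a * g^-1) H; rewrite !gnorm => ->.
  by rewrite -[LHS]mulgA -gVa !gnorm.
have := congr1 (fun u => u * g * a^-1 * z^-1 * g^-1 * a^-1) H; rewrite !gnorm => ->.
by rewrite -[_ * g^-1 * a]mulgA gVa !gnorm.
Qed.

Lemma satisfies5 : fib_rec U -> satisfies rel5 gen5 <-> eqs5.
Proof.
move=> UE.
have U8 : U 8%N = (U 6%N)^-1 * U 7%N by rewrite UE.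
have U9 : U 9%N = (U 7%N)^-1 * U 8%N by rewrite UE.
split=> [Rg|[[vb wv [uv0 uv1]] [uvb w0 w1 sphere]] a b].
  have wv i : 1 <= i <= 2 -> w * v i = v i * w.
    by move=> Hi; have := Rg _ _ (rel5_wv Hi); rewrite !wevalE weval_v5.
  have wE0 : w * U 0%N = U 8%N * w.
    have := Rg _ _ rel5_u7; rewrite !wevalE !weval_u5 //= U8.
    by move/(congr1 (fun x => (U 6%N)^-1 * x * U 6%N * w * U 0%N)); rewrite !gnorm.
  have wE1 : w * U 1%N = U 9%N * w.
    have := Rg _ _ rel5_u8; rewrite !wevalE !weval_u5 //= U9.
    move/(congr1 (fun x => (U 7%N)^-1 * x * U 7%N * w * U 1%N)); rewrite !gnorm.
    by rewrite -mulgA wE0 !gnorm.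
  split; split=> //.
  - by have := Rg _ _ rel5_vv; rewrite !wevalE !weval_v5.
  - split.
      by have := Rg _ _ rel5_u1v2; rewrite !wevalE !weval_v5 // !weval_u5.
    by have := Rg _ _ rel5_u2v2; rewrite !wevalE !weval_v5 // !weval_u5 // UE mulgA.
  - move=> i; rewrite leq_eqVlt => /orP[/eqP->|].
      have := Rg _ _ rel5_uv8; rewrite !wevalE !weval_v5 // !weval_u5 //.
      move/triple_move_conj => /(_ (wv 1%N isT)).
      by rewrite -[w * U 0%N](mulgVK w) wE0 wE1 !mulgK.
    rewrite ltnS leq_eqVlt => /orP[/eqP->|Hi].
      have := Rg _ _ rel5_uv7; rewrite !wevalE !weval_v5 // !weval_u5 //.
      have -> : U 8%N = w * U 0%N * w^-1 by rewrite wE0 mulgK.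
      by move=> H; apply/triple_move; rewrite !mulgA.
    have := Rg _ _ (rel5_uv (i := i.+1) Hi).
    rewrite !wevalE !weval_v5 // !weval_u5 //; try lia.
    by move/triple_move.
  - by have := Rg _ _ rel5_sphere; rewrite !wevalE !weval_v5 // !weval_u5.
case=> {a b} [|i Hi|||i Hi|||i Hi|||].
- by rewrite !wevalE !weval_v5.
- by rewrite !wevalE !weval_v5 // wv.
- by rewrite !wevalE !weval_v5 // !weval_u5.
- by rewrite !wevalE !weval_v5 // !weval_u5 // uv1 UE mulgA.
- rewrite !wevalE !weval_v5 // !weval_u5; try lia.
  case: i Hi => // i Hi; apply/triple_move/uvb; lia.
- rewrite !wevalE !weval_v5 // !weval_u5 //=.
  have := uvb 6%N isT; have -> : U 8%N = w * U 0%N * w^-1 by rewrite w0 mulgK.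
  by move/triple_move; rewrite !mulgA.
- rewrite !wevalE !weval_v5 // !weval_u5 //=.
  by apply/triple_move_conj; [exact: wv | rewrite w0 w1 !mulgK; apply: uvb].
- rewrite !wevalE !weval_u5; try lia.
  by case: i Hi => // i Hi /=; rewrite UE !gnorm.
- rewrite !wevalE !weval_u5 //=.
  have wV : w * (U 0%N)^-1 = (U 8%N)^-1 * w.
    by apply: (mulIg (U 0%N)); rewrite mulgVK -mulgA w0 mulKg.
  by rewrite -[_ * w * _]mulgA wV U8 !gnorm.
- rewrite !wevalE !weval_u5 //=.
  have wV : w * (U 1%N)^-1 = (U 9%N)^-1 * w.
    by apply: (mulIg (U 1%N)); rewrite mulgVK -mulgA w1 mulKg.
  by rewrite w0 -[_ * w * _]mulgA wV U9 !gnorm.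
- by rewrite !wevalE !weval_v5 // !weval_u5.
Qed.

Lemma pal2 : pal 2 v = v 1%N * v 2%N ^+ 2 * v 1%N.
Proof. by rewrite pal_recl pal1. Qed.

Hypothesis UE : fib_rec U.
Hypothesis rels : eqs5.

Lemma w_shift5 i : w * U i = U (i + 8)%N * w.
Proof. by have [_ [_ w0 w1 _]] := rels; apply: fib_conj. Qed.

Lemma v2_shift i : U i * v 2%N = v 2%N * U i.+1.
Proof.
have [[_ _ [uv0 uv1]] _] := rels; apply: (mulgI (v 2%N)^-1); rewrite mulKg mulgA.
rewrite (fib_conj (g := (v 2%N)^-1) (j := 1) UE) ?addn1 ?mulgVK //.
  by apply: (mulIg (v 2%N)); rewrite mulgVK -mulgA uv0 mulKg.
by apply: (mulIg (v 2%N)); rewrite mulgVK -mulgA uv1 mulKg.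
Qed.

End FiveStringsRelations.

Lemma braid_conj (E : groupType) (g a x y z x' y' z' : E) : g * a = a * g ->
  g * x = x' * g -> g * y = y' * g -> g * z = z' * g ->
  x * a * z = a * y * a -> x' * a * z' = a * y' * a.
Proof.
move=> ga gx gy gz xaz; apply: (mulIg g).
have -> : x' * a * z' * g = g * (x * a * z).
  by rewrite !mulgA gx -[x' * g * a]mulgA ga -!mulgA gz.
by rewrite xaz !mulgA ga -[a * g * y]mulgA gy -!mulgA ga.
Qed.

(** In place of a [v 3], the element [w] is used: it commutes with [v 1] and shifts by 8, so the
    relation at index 8 comes from the one at index 0. Conjugating the sphere relation by [(U 0)^-1]
    shifts it, since [U 6 U 8 = U 7]. *)
Lemma eqs5_shift (E : groupType) (w : E) (U v : nat -> E) :
  fib_rec U -> eqs5 w U v -> eqs5 w (fun i => U i.+1) v.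
Proof.
move=> UE rels; have [[vb wv _] [uvb _ _ sphere]] := rels.
have w_shift i := w_shift5 UE rels i.
split; split=> //.
- by rewrite !(v2_shift UE rels).
- move=> i; rewrite leq_eqVlt => /orP[/eqP->|Hi]; last exact: uvb.
  apply: (braid_conj (wv 1%N isT) (w_shift 0%N) (w_shift 1%N) (w_shift 2%N)).
  exact: uvb.
- rewrite -[RHS](mulVg (U 0%N)) -[X in _ = X * _]mulg1 -sphere.
  move: (v 1%N * _ * _) => A.
  rewrite -!mulgA w_shift !mulgA -(UE 0%N) -[_ * U 6%N * U _]mulgA.
  by rewrite (UE 6%N) mulVKg.
Qed.

Lemma eqs5_of_ext (E : groupType) (T : E) (U V : nat -> E) :
  fib_rec U -> shift_eqs 1 T U V -> ext_eqs 1 T U V -> eqs5 (T ^+ 8) U V.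
Proof.
move=> UE [TU TV] [[far braid uv] [u012 uvb sphere]].
have UV1 i : U i * V 1%N * U i.+2 = V 1%N * U i.+1 * V 1%N.
  elim: i => // i; apply: (braid_conj (TV 1%N isT)); exact: TU.
split; split=> //.
- exact: (braid 1%N).
- by move=> i Hi; apply/commute_sym/commuteX/commute_sym/TV.
- split; first exact: uv.
  apply: (mulIg T); rewrite -[LHS]mulgA -TV // [LHS]mulgA -[U 1%N * T]TU.
  by rewrite -[RHS]mulgA -[U 2%N * T]TU [RHS]mulgA -TV // -!mulgA uv.
- by rewrite exp_shift.
- by rewrite exp_shift.
- by rewrite -pal2.
Qed.

Lemma presents5 (B : groupType) (s : nat -> B) : is_sphere_braid_group 5 s ->
  presents (lcs B 2) (family5 s) rel5.
Proof.
move=> hB; set K : groupType := presented rel5.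
pose w : K := pgen rel5 G5_w.
pose v i : K := nth1 (fun j : 'I_2 => pgen rel5 (G5_v j)) i.
pose u i : K := if insub i is Some j then pgen rel5 (G5_u j) else 1.
have uE (j : 'I_8) : u j = pgen rel5 (G5_u j).
  by rewrite /u insubT //= => H; congr (pgen _ (G5_u _)); apply: val_inj.
have vE (j : 'I_2) : v j.+1 = pgen rel5 (G5_v j).
  by rewrite /v /nth1 insubT //= => H; congr (pgen _ (G5_v _)); apply: val_inj.
have KuE : gen5 w u v = pgen rel5.
  by apply/funext => -[|j|j] //; [apply: uE | apply: vE].
(* [u] lists the eight generators, with value 1 afterwards; [U] continues them by the recursion to
   all indices. *)
pose U := fibseq (u 0%N) (u 1%N); have UE : fib_rec U := fibseq_rec _ _.
have u_rec i : i <= 5 -> u i.+2 = (u i)^-1 * u i.+1.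
  move=> Hi; have := satisfies_pgen (rel5_u (i := i.+1) Hi).
  rewrite -KuE !wevalE !weval_u5 /=; try lia.
  by move/(congr1 (fun x => (u i)^-1 * x^-1 * u i.+1)); rewrite !gnorm => ->.
have uU i : i <= 7 -> u i = U i.
  suff: (i <= 7 -> u i = U i) /\ (i.+1 <= 7 -> u i.+1 = U i.+1) by case.
  elim: i => // i [IHi IHi1]; split=> // Hi.
  by rewrite u_rec ?UE ?IHi ?IHi1 //; lia.
have KE : gen5 w U v = pgen rel5.
  by rewrite -KuE; apply/funext => -[|j|j] //=; rewrite uU // -ltnS.
have rels : eqs5 w U v.
  by apply/satisfies5 => //; rewrite KE; apply: satisfies_pgen.
have [alpha alphaE] : exists alpha : {multiplicative K -> K},
    forall x, alpha (pgen _ x) = gen5 w (fun i => U i.+1) v x.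
  apply/presented_lift/satisfies5; first by move=> i; apply: UE.
  exact: eqs5_shift.
have alphaU i : alpha (U i) = U i.+1.
  suff: alpha (U i) = U i.+1 /\ alpha (U i.+1) = U i.+2 by case.
  elim: i => [|i [IHi IHi1]].
    have u0E : U 0%N = pgen rel5 (G5_u ord0) by rewrite -uU // (uE ord0).
    have u1E : U 1%N = pgen rel5 (G5_u (Ordinal (isT : 1 < 8))).
      by rewrite -uU // -uE.
    by split; [rewrite u0E alphaE | rewrite u1E alphaE].
  by split=> //; rewrite UE gmulfM gmorphV IHi IHi1 -UE.
have alphav i : 1 <= i <= 2 -> alpha (v i) = v i.
  case: i => // i Hi; pose j := Ordinal (n := 2) (m := i) Hi.
  by rewrite (vE j) alphaE; apply: (vE j).
have iterU j i : iter j alpha (U i) = U (i + j)%N.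
  by elim: j => [|j IHj]; rewrite ?addn0 // addnS iterS IHj alphaU.
have sP := sb_group_eqs (n := 5) isT hB.
have famE : family5 s = gen5 (s 1%N ^+ 8) (Us s) (Vs s).
  by apply/funext => -[|j|j].
have [[vb wv _] [uvb w0 w1 sphere]] := rels.
have [sU sV] := std_shift sP.
have srels := eqs5_of_ext (std_fib sP) (std_shift sP) (std_ext sP).
apply: (presents_lcs2 (p := 1) hB (alpha := alpha) (w := w) (u := U 0%N) (v := v)).
- by rewrite famE; apply/satisfies5 => //; apply: (std_fib sP).
- have [_ NM NV] := lcs_subgroup B 2.
  rewrite famE => -[|j|j]; rewrite /gen5; [|exact: (lcs_Us hB)|]; last first.
    by apply: (lcs_Vs hB); rewrite /= ltn_ord.
  (* By the sphere relation [sigma_1^8] is the inverse of a product of elements [Us] and [Vs], all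
     in the commutator subgroup. *)
  have [_ [_ _ _ /mulg1_eq <-]] := srels; rewrite -pal2; apply: NV; apply: (NM).
    apply: (NM); [exact: (lcs_Us hB) | rewrite pal2].
    by apply: (NM); [apply: (NM); [|apply: (NM)] |]; apply: (lcs_Vs hB).
  exact: (lcs_Us hB).
- exact: (alphaE G5_w).
- rewrite -KE => -[|j|j].
  + rewrite -[gen5 _ _ _ _]/w mulgK; apply: iter_fix; exact: (alphaE G5_w).
  + by rewrite -[gen5 _ _ _ _]/(U j) iterU (w_shift5 UE rels) mulgK.
  + have Hj : 1 <= j.+1 <= 2 by rewrite /= ltn_ord.
    have wvj : w * v j.+1 = v j.+1 * w := wv _ Hj.
    rewrite -[gen5 _ _ _ _]/(v j.+1) wvj mulgK; apply: iter_fix; exact: alphav.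
- exact: alphav.
- by move=> [|[|[|i]]] [|[|[|j]]].
- by move=> [|[|i]].
- move=> j Hj; rewrite !(iterU _ 0%N).
  by case: j Hj => [|[|[|]]] // _; apply: v2_shift rels _.
- by rewrite !(iterU _ 0%N) UE mulVKg.
- by rewrite !(iterU _ 0%N); apply: (uvb 0%N).
- by rewrite !(iterU _ 0%N) pal2.
- move=> f; rewrite famE => fE; split.
    by rewrite -uU // (uE ord0) fE.
  move=> [|i] // Hi; have := fE (G5_v (Ordinal (n := 2) (m := i) Hi)).
  by rewrite -vE.
- move=> f; rewrite famE => fE x.
  have fu i : i <= 7 -> f (U i) = Us s i.
    by move=> Hi; rewrite -uU // (uE (Ordinal (Hi : i < 8))) fE.
  have fU i : f (U i) = Us s i.
    rewrite (fibseq_uniq (std_fib sP)) -(fu 0%N) // -(fu 1%N) //.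
    by apply: (fibseq_uniq (U := fun i => f (U i))) => k; rewrite UE gmulfM gmorphV.
  rewrite alphaE; case: x => [|j|j]; rewrite /gen5.
  + have -> : f w = s 1%N ^+ 8 by rewrite fE.
    by rewrite -expgS -expgSr.
  + by rewrite fU sU.
  + have -> : f (v j.+1) = Vs s j.+1 by rewrite vE fE.
    by apply: sV; rewrite /= ltn_ord.
- move=> F h L hw hU hV; rewrite famE => -[|j|j].
  + by rewrite -[gen5 _ _ _ _]/(s 1%N ^+ 8) gmorphX hw.
  + by rewrite -[gen5 _ _ _ _]/(Us s j) hU (iterU _ 0%N) add0n -uU ?uE // -ltnS.
  + by rewrite hV ?vE //= ltn_ord.
Qed.

(** * Four strings *)

Section QuaternionAction.
Variables (E : groupType) (a b x y : E).

Definition eqs4 : Prop :=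
  [/\ x ^+ 4 = 1, commute (x ^+ 2) a & commute (x ^+ 2) b]
  /\ [/\ commute x (b * a), a^-1 * x^-1 * a = b * x * b^-1
       & a^-1 * x^-1 * a = a * x * a^-1 * x].

Definition gen4 (g : gens4) : E :=
  match g with G4_1 => a | G4_2 => b | G4_3 => x end.

Lemma comm_eq1 (g h : E) : comm g h = 1 <-> commute g h.
Proof.
split=> [/(congr1 (fun z => z * h * g))|gh].
  by rewrite /comm !gnorm.
by rewrite /comm gh !gnorm.
Qed.

Lemma satisfies4 : satisfies rel4 gen4 <-> eqs4.
Proof.
split=> [Rg|[[x4 za zb] [xba j1 j2]] _ _ []]; rewrite ?wevalE //.
- have x4 := Rg _ _ rel4_ord; have c1 := Rg _ _ rel4_c1.
  have c2 := Rg _ _ rel4_c2; have c3 := Rg _ _ rel4_c3.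
  split; split=> //; try exact/comm_eq1.
  + exact: (Rg _ _ rel4_j1).
  + exact: (Rg _ _ rel4_j2).
- exact/comm_eq1.
- exact/comm_eq1.
- exact/comm_eq1.
Qed.

Definition q8_rels : Prop := x ^+ 2 = y ^+ 2 /\ x * y * x^-1 = y^-1.

Definition q8_action : Prop :=
  [/\ a * x = y * a, a * y = x * y * a, b * x = y * x * b & b * y = x * b].

Lemma q8_facts : q8_rels ->
  [/\ x * y * x = y, y * x * y = x, commute (x ^+ 2) y & x ^+ 2 * x ^+ 2 = 1].
Proof.
move=> [x2 xy]; have zy : commute (x ^+ 2) y.
  by rewrite x2; apply/commute_sym/commuteX.
have xyV : x * y = y^-1 * x by rewrite -xy mulgVK.
have xyx : x * y * x = y by rewrite xyV -mulgA -expg2 x2 expg2 mulKg.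
have yxy : y * x * y = x by rewrite -mulgA xyV mulVKg.
split=> //; apply: (mulgI y); rewrite mulg1 mulgA -[y * _]zy.
have xyV' : x * y = y * x^-1 by rewrite -[in RHS]xyx mulgK.
by rewrite expg2 -!mulgA [x * (y * _)]mulgA xyV' !mulgA mulgVK xyV' mulgVK.
Qed.

Lemma eqs4_of_action : q8_rels -> q8_action -> eqs4.
Proof.
move=> qxy [ax ay bx bY].
have [xyx yxy zy z2] := q8_facts qxy; have [x2 _] := qxy.
have x3 : x * x ^+ 2 = x^-1.
  by apply: (mulIg x); rewrite mulVg -[RHS]z2 !expg2 !mulgA.
have ayx : a * y * x = x^-1 * a.
  by rewrite ay -mulgA ax !mulgA -[x * y * y]mulgA -[y * y]expg2 -x2 x3.
have xa : a^-1 * x^-1 * a = y * x by rewrite -mulgA -ayx -[a * y * x]mulgA mulKg.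
split; split.
- by rewrite (expgnDr x 2 2).
- apply/commute_sym; rewrite /commute expg2 mulgA ax -mulgA ax mulgA.
  by rewrite -[y * y]expg2 -x2.
- apply/commute_sym; rewrite /commute expg2 mulgA bx -mulgA bx !mulgA.
  by rewrite yxy.
- by rewrite /commute -[RHS]mulgA ax [RHS]mulgA bY -mulgA.
- by rewrite xa bx mulgK.
- by rewrite xa ax mulgK.
Qed.

(** With [y = a x a^-1], relation [j2] reads [a^-1 x^-1 a = y x] and yields the action of [a] on
    [y]; then [j1] gives the action of [b] on [x], and [xba] its action on [y]. With the preceding
    lemma, [rel4] encodes exactly this action on the quaternion relations. *)
Lemma action_of_eqs4 : y = a * x * a^-1 -> eqs4 -> q8_rels /\ q8_action.
Proof.
move=> yE [[x4 za zb] [xba j1 j2]].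
have ax : a * x = y * a by rewrite yE mulgVK.
have x2 : x ^+ 2 = y ^+ 2.
  rewrite yE [in RHS]expg2 !mulgA mulgVK -[a * x * x]mulgA -[x * x]expg2.
  by rewrite -za mulgK.
have yx : a^-1 * x^-1 * a = y * x by rewrite j2 yE.
have ayx : x^-1 * a = a * y * x by rewrite -[RHS]mulgA -yx !mulgA mulgV mul1g.
have ay : a * y = x^-1 * y^-1 * a.
  by apply: (mulIg x); rewrite -ayx -mulgA ax !mulgA mulgVK.
have z2 : x ^+ 2 * x ^+ 2 = 1 by rewrite -(expgnDr x 2 2).
have xV : x^-1 = x * x ^+ 2.
  by apply: (mulIg x); rewrite mulVg -[LHS]z2 !expg2 !mulgA.
have yV : y^-1 = y * x ^+ 2.
  by apply: (mulIg y); rewrite mulVg -[LHS]z2 x2 !expg2 !mulgA.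
(* The relation [y^2 = x^2] conjugated by [a], which fixes [x^2] and sends [y] to [x^-1 y^-1]. *)
have xyxy : x^-1 * y^-1 * x^-1 * y^-1 = x ^+ 2.
  apply: (mulIg a); rewrite za [in RHS]x2 expg2 mulgA ay -[RHS]mulgA ay.
  by rewrite !mulgA.
have zy : commute (x ^+ 2) y by rewrite x2; apply/commute_sym/commuteX.
have zx : commute (x ^+ 2) x by apply/commute_sym/commuteX.
have yxy : y * x * y = x.
  have := congr1 inv xyxy; rewrite !gnorm => yxyx.
  apply: (mulIg x); rewrite yxyx -expg2; apply: (mulgI (x ^+ 2)).
  by rewrite z2 expg2 !gnorm.
have xyE : x * y = x^-1 * y^-1.
  by rewrite xV yV -zy -[RHS]mulgA [x ^+ 2 * (_ * y)]mulgA z2 mul1g.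
split; first split=> //.
  by apply: (mulIg x); rewrite mulgVK -[in RHS]yxy -mulgA mulKg.
split=> //.
- by rewrite ay -xyE.
- by apply: (mulIg b^-1); rewrite mulgK -j1 yx.
- by apply: (mulIg a); rewrite -mulgA -ax mulgA -[RHS]mulgA xba.
Qed.

End QuaternionAction.

(* Here [x^2] is central in the subgroup generated by the [U i] and [x], and for
   [X i = U i x (U i)^-1] the relations [U i x U (i+2) = x U (i+1) x] read
   [X i = x X (i+1)]; so [x] and any [X (i+1)] satisfy the relations of Q8. *)
Lemma eqs4_of_ext (E : groupType) (T : E) (U V : nat -> E) :
  fib_rec U -> shift_eqs 0 T U V -> ext_eqs 0 T U V ->
  eqs4 (U 2%N) (U 3%N) (V 1%N).
Proof.
move=> UE TUV UVP; have [TU TV] := TUV.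
have [_ [_ uvb cyc]] := eqs6_of_ext UE TUV UVP.
(* Here [2n - 2 = 6], so [k = 0], and [A = x^2] commutes with [U 0] and [U 1]. *)
have := cyc 0%N 6%N (or_intror (or_intror erefl)) erefl.
rewrite pal1 mulg1; move: (V 1%N) (TV 1%N isT) uvb => x Tx uvb [z0 z1].
have zU i : commute (x ^+ 2) (U i) by rewrite /commute (fib_conj UE z0 z1) addn0.
have R i : U i * x * U i.+2 = x * U i.+1 * x.
  by elim: i => // i; apply: (braid_conj Tx); exact: TU.
have [X XE] : exists X, forall i, X i = U i * x * (U i)^-1.
  by exists (fun i => U i * x * (U i)^-1).
have UX i : U i * x = X i * U i by rewrite XE mulgVK.
have XS i : X i = x * X i.+1.
  apply: (mulIg (U i.+1)); rewrite -[RHS]mulgA -UX mulgA -R UE.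
  by rewrite XE !mulgA.
have X2 i : X i * X i = x ^+ 2.
  by apply: (mulIg (U i)); rewrite zU -mulgA -UX mulgA -UX expg2 mulgA.
have xXx i : x * X i.+1 * x = X i.+1.
  by apply: (mulIg (X i.+1)); rewrite X2 -[RHS](X2 i) (XS i) !mulgA.
have qxX i : q8_rels x (X i.+1).
  split; first by rewrite [RHS]expg2 X2.
  have x2 : x * x = X i.+1 * X i.+1 by rewrite X2.
  apply: (mulIg (x * x)); rewrite mulgA mulgVK xXx.
  by rewrite x2 mulKg.
have qx := qxX 1%N; have [xyx yxy zy z2] := q8_facts qx.
apply: (eqs4_of_action qx).
have Y3 : X 2%N = x * X 3%N := XS 2%N.
have UXX i : U i * X i = x * X i * U i.
  have Ui : U i * U i.+2 = U i.+1 by rewrite UE mulVKg.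
  (* [X i = x^2 X (i+2)], and [U i] conjugates [X (i+2)] to [X (i+1)] because
     [U (i+1) = U i U (i+2)]. *)
  rewrite {1}XS (XS i.+1) [x * (x * _)]mulgA -[x * x]expg2 mulgA -zU -mulgA.
  have -> : U i * X i.+2 = X i.+1 * U i by rewrite !XE -Ui !gnorm.
  by rewrite [in RHS]XS expg2 !mulgA.
split=> //.
- by rewrite UX Y3 xXx.
- rewrite {1}Y3 mulgA UX -mulgA UXX !mulgA.
  by have [_ -> _ _] := q8_facts (qxX 2%N).
Qed.

Section Action.
Variables (E : groupType) (a b x : E).
Hypothesis abx : eqs4 a b x.
Local Notation y := (a * x * a^-1).

(** Checked through the action on Q8: the role of [y] is now played by [b x b^-1 = y x]. *)
Lemma eqs4_shift : eqs4 b (a^-1 * b) x.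
Proof.
have [qxy [ax ay bx bY]] := action_of_eqs4 erefl abx.
move: (a * x * a^-1) qxy ax ay bx bY => y' qxy ax ay bx bY.
have [xyx yxy zy z2] := q8_facts qxy; have [x2 xyV] := qxy.
have ay' : a^-1 * y' = x * a^-1 by apply: (mulgI a); rewrite mulVKg mulgA ax mulgK.
have ax' : a^-1 * x = x * y' * a^-1.
  apply: (mulgI a); rewrite mulVKg !mulgA ax -[y' * a * y']mulgA ay.
  by rewrite !mulgA yxy mulgK.
apply: (eqs4_of_action (y := y' * x)).
- split; first by rewrite [in RHS]expg2 mulgA yxy expg2.
  rewrite !mulgA mulgK invgM; apply: (mulgI x); apply: (mulIg y').
  rewrite mulVKg mulVg -[LHS]mulgA -[x * y' * y']mulgA -[y' * y']expg2 -x2.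
  by rewrite -[RHS]z2 !expg2 !mulgA.
- split=> //.
  + by rewrite mulgA bY -mulgA bx !mulgA.
  + rewrite -mulgA bx !mulgA ay' -[x * _ * x]mulgA ax' !mulgA.
    by rewrite -[x * x]expg2 zy expg2 !mulgA.
  + have byx : b * (y' * x) = y' * b by rewrite mulgA bY -mulgA bx !mulgA xyx.
    by rewrite -mulgA byx mulgA ay' -mulgA.
Qed.

(** The actions of [a] and [b] show that this commutator centralizes [x], as needed for [w] to
    commute with [x]. *)
Lemma commute_x_fib_y : commute (fib_y a b) x.
Proof.
have [qxy [ax ay bx bY]] := action_of_eqs4 erefl abx.
move: (a * x * a^-1) qxy ax ay bx bY => y' qxy ax ay bx bY.
have [xyx yxy zy z2] := q8_facts qxy; have [x2 xyV] := qxy.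
have ax' : a^-1 * x = x * y' * a^-1.
  apply: (mulgI a); rewrite mulVKg !mulgA ax -[y' * a * y']mulgA ay.
  by rewrite !mulgA yxy mulgK.
have xyyy : x * y' * y' * y' = y' * x.
  apply: (mulgI x); rewrite !mulgA xyx -[x * x]expg2 -[x ^+ 2 * _ * _]mulgA.
  by rewrite -[y' * y']expg2 -x2 z2 mul1g.
apply: (mulgI b); rewrite /fib_y !mulgA mulgV mul1g bx.
rewrite -[_ * b * b^-1]mulgA mulgV mulg1.
rewrite -[LHS]mulgA ax' !mulgA -[a * b * x]mulgA bx !mulgA -[_ * b * y']mulgA bY.
by rewrite !mulgA ay -[_ * a * x]mulgA ax !mulgA -[_ * a * x]mulgA ax !mulgA xyyy.
Qed.

End Action.
Lemma presents4 (B : groupType) (s : nat -> B) : is_sphere_braid_group 4 s ->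
  presents (lcs B 2) (family4 s) rel4.
Proof.
move=> hB; set K : groupType := presented rel4.
pose a : K := pgen rel4 G4_1; pose b : K := pgen rel4 G4_2.
pose x : K := pgen rel4 G4_3.
have KE : gen4 a b x = pgen rel4 by apply/funext => -[].
have abx : eqs4 a b x.
  by apply/satisfies4; rewrite KE; apply: satisfies_pgen.
(* [g1] and [g2] are u_3 and u_4, so the recursion is solved backwards for its two initial terms. *)
pose U := fibseq (a * b^-1 * a^-1) (a * b^-1).
have UE : fib_rec U := fibseq_rec _ _.
have U2 : U 2%N = a by rewrite UE /U /= !gnorm.
have U3 : U 3%N = b by rewrite UE U2 /U /= !gnorm.
have [alpha alphaE] : exists alpha : {multiplicative K -> K},
    forall g, alpha (pgen _ g) = gen4 b (a^-1 * b) x g.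
  by apply/presented_lift/satisfies4; apply: eqs4_shift.
have alphaa : alpha a = b by apply: alphaE.
have alphab : alpha b = a^-1 * b by apply: alphaE.
have alphax : alpha x = x by apply: alphaE.
have alphaU i : alpha (U i) = U i.+1.
  suff: alpha (U i) = U i.+1 /\ alpha (U i.+1) = U i.+2 by case.
  elim: i => [|i [IHi IHi1]].
    by rewrite U2 /U /= !gmulfM !gmorphV alphaa alphab !gnorm.
  by split=> //; rewrite UE gmulfM gmorphV IHi IHi1 -UE.
have iterU j i : iter j alpha (U i) = U (i + j)%N.
  by elim: j => [|j IHj]; rewrite ?addn0 // addnS iterS IHj alphaU.
have [qxy [ax ay bx bY]] := action_of_eqs4 erefl abx.
move: (a * x * a^-1) qxy ax ay bx bY => y qxy ax ay bx bY.
have [xyx yxy zy z2] := q8_facts qxy; have [x2 xyV] := qxy.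
have [[x4 za zb] _] := abx.
have zU i : commute (x ^+ 2) (U i.+2).
  elim: (i.+2) {-2}i (erefl i.+2) => // j _ {}i _.
  suff: commute (x ^+ 2) (U i.+2) /\ commute (x ^+ 2) (U i.+3) by case.
  elim: i {j} => [|i [IHi IHi1]]; first by rewrite U2 U3.
  by split=> //; rewrite UE; apply: commuteM => //; apply: commuteV.
have sP := sb_group_eqs (n := 4) isT hB.
have famE : family4 s = gen4 (Us s 2) (Us s 3) (Vs s 1) by apply/funext => -[].
have [sU sV] := std_shift sP.
have srels := eqs4_of_ext (std_fib sP) (std_shift sP) (std_ext sP).
have yE : fib_y (U 0%N) (U 1%N) = fib_y a b by rewrite -(fib_y_shift UE 2) U2 U3.
have zY : commute (x ^+ 2) (fib_y a b).
  by apply/commute_sym/commuteX/commute_x_fib_y.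
(* Again [w = y A^-1], where now [A = x^2]. *)
pose w := fib_y a b * (x ^+ 2)^-1.
have zVU i : (x ^+ 2)^-1 * U i.+2 = U i.+2 * (x ^+ 2)^-1.
  exact/commute_sym/commuteV/commute_sym.
have wU i : w * U i.+2 = U (i.+2 + 6) * w.
  by rewrite /w -mulgA zVU mulgA -yE fib_period // !mulgA.
apply: (presents_lcs2 (p := 0) hB (alpha := alpha) (w := w) (u := U 0%N)
  (v := fun=> x)).
- by rewrite famE; apply/satisfies4.
- rewrite famE => -[]; [exact: (lcs_Us hB) | exact: (lcs_Us hB) |].
  exact: (lcs_Vs hB).
- rewrite /w gmulfM gmorphV gmorphX alphax -yE gmorph_fib_y !alphaU.
  by rewrite (fib_y_shift UE 1).
- rewrite -KE => -[].
  + by rewrite -[gen4 _ _ _ _]/a -U2 iterU wU mulgK.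
  + by rewrite -[gen4 _ _ _ _]/b -U3 iterU wU mulgK.
  + have wx : w * x = x * w.
      apply/commute_sym/commuteM; first exact/commute_sym/commute_x_fib_y.
      exact/commuteV/commuteX.
    by rewrite -[gen4 _ _ _ _]/x wx mulgK; apply: iter_fix.
- by [].
- by move=> [|[|i]] [|[|j]].
- by move=> [|i].
- by move=> [|[|j]].
- by rewrite !(iterU _ 0%N) UE mulVKg.
- rewrite !(iterU _ 0%N) !add0n U2 /U /=.
  have aVx : a^-1 * x = x * y * a^-1.
    apply: (mulgI a); rewrite mulVKg !mulgA ax -[y * a * y]mulgA ay.
    by rewrite !mulgA yxy mulgK.
  have bVx : b^-1 * x = y * b^-1.
    by apply: (mulgI b); rewrite mulVKg mulgA bY mulgK.
  have bVy : b^-1 * y = y * x * b^-1.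
    apply: (mulgI b); rewrite mulVKg !mulgA bY -[x * b * x]mulgA bx.
    by rewrite !mulgA xyx mulgK.
  have -> : x * (a * b^-1) * x = x ^+ 2 * y * a * b^-1.
    by rewrite -[LHS]mulgA -[a * b^-1 * x]mulgA bVx [a * _]mulgA ay expg2 !mulgA.
  rewrite -[_ * a^-1 * x]mulgA aVx !mulgA mulgVK -[a * _ * x]mulgA bVx.
  rewrite -[a * _ * y]mulgA -[y * _ * y]mulgA bVy !mulgA.
  by rewrite -[a * y * y]mulgA -[y * y]expg2 -x2 -za -[_ * a * x]mulgA ax !mulgA.
- rewrite !(iterU _ 0%N) pal1 !add0n.
  have zw : x ^+ 2 * w = fib_y a b by rewrite /w mulgA zY mulgK.
  rewrite -[_ * x ^+ 2 * _]mulgA zU -[LHS]mulgA -[U _ * x ^+ 2 * w]mulgA zw.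
  by rewrite [U 4%N]UE U2 U3 /U /= /fib_y !gnorm.
- move=> f; rewrite famE => fE; split; last by move=> [|[|i]] // _; apply: (fE G4_3).
  rewrite /U /= !gmulfM !gmorphV (fE G4_1) (fE G4_2) /gen4.
  move: (Us s) (std_fib sP) => V VE.
  by rewrite (VE 1%N) (VE 0%N) !gnorm.
- move=> f; rewrite famE => fE g; rewrite alphaE; case: g; rewrite /gen4.
  + by rewrite (fE G4_2) sU.
  + by rewrite gmulfM gmorphV (fE G4_1) (fE G4_2) sU (std_fib sP).
  + by rewrite (fE G4_3) sV.
- move=> F h L _ hU hV; rewrite famE => -[].
  + by rewrite -[gen4 _ _ _ _]/(Us s 2) hU (iterU _ 0%N) U2.
  + by rewrite -[gen4 _ _ _ _]/(Us s 3) hU (iterU _ 0%N) U3.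
  + exact: (hV 1%N).
Qed.

(** * The semidirect product of Q8 by the free group *)

Section QuaternionExtension.

Lemma satisfiesQ8 (E : groupType) (g : Q8_gen -> E) :
  satisfies Q8_rel g <-> q8_rels (g Q8_x) (g Q8_y).
Proof.
split=> [Rg|[x2 xy] _ _ []] //; split; [exact: Rg Q8_sq | exact: Rg Q8_conj].
Qed.

Definition q8_gen (E : Type) (x y : E) (g : Q8_gen) : E :=
  match g with Q8_x => x | Q8_y => y end.

Definition f2_gen (E : Type) (x y : E) (g : F2_gen) : E :=
  match g with F2_a => x | F2_b => y end.

Lemma Q8_lift (E : groupType) (x y : E) : q8_rels x y ->
  exists f : {multiplicative Q8 -> E}, f Qx = x /\ f Qy = y.
Proof.
move=> xy; have [f fE] : exists f : {multiplicative Q8 -> E},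
    forall g, f (pgen _ g) = q8_gen x y g.
  by apply/presented_lift/satisfiesQ8.
by exists f; rewrite !fE.
Qed.

Lemma Q8_ext (E : groupType) (f g : {multiplicative Q8 -> E}) :
  f Qx = g Qx -> f Qy = g Qy -> f =1 g.
Proof. by move=> fx fy; apply: presented_ext => -[]. Qed.

Lemma F2_lift (E : groupType) (x y : E) :
  exists f : {multiplicative F2 -> E}, f Fa = x /\ f Fb = y.
Proof.
have [f fE] : exists f : {multiplicative F2 -> E},
    forall g, f (pgen _ g) = f2_gen x y g by apply: presented_lift.
by exists f; rewrite !fE.
Qed.

Lemma F2_ext (E : groupType) (f g : {multiplicative F2 -> E}) :
  f Fa = g Fa -> f Fb = g Fb -> f =1 g.
Proof. by move=> fx fy; apply: presented_ext => -[]. Qed.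

Lemma Q8_rels : q8_rels Qx Qy.
Proof.
by apply/(satisfiesQ8 (pgen Q8_rel))/satisfies_pgen.
Qed.

Lemma q8_intro (E : groupType) (x y : E) :
  x * x = y * y -> x * y * x = y -> q8_rels x y.
Proof.
move=> x2 xyx; split; first by rewrite expg2 x2.
by apply: (mulIg (x * x)); rewrite mulgA mulgVK xyx x2 mulKg.
Qed.

(** [x'] and [y'] are the intended images of [Qx] and [Qy] under the inverse automorphism. *)
Lemma Q8_aut (x y x' y' : Q8) : q8_rels x y -> q8_rels x' y' ->
  (forall f : {multiplicative Q8 -> Q8}, f Qx = x -> f Qy = y ->
     f x' = Qx /\ f y' = Qy) ->
  (forall f : {multiplicative Q8 -> Q8}, f Qx = x' -> f Qy = y' ->
     f x = Qx /\ f y = Qy) ->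
  exists p : bij Q8, [/\ {morph p : u v / u * v}, p Qx = x & p Qy = y].
Proof.
move=> /Q8_lift[f [fx fy]] /Q8_lift[g [gx gy]] fg gf.
have [fx' fy'] := fg f fx fy; have [gx' gy'] := gf g gx gy.
have fK : cancel f g.
  by apply: (Q8_ext (f := g \o f) (g := idfun)); rewrite /= ?fx ?fy.
have gK : cancel g f.
  by apply: (Q8_ext (f := f \o g) (g := idfun)); rewrite /= ?gx ?gy.
by exists (Bij fK gK); split=> //; apply: gmulfM.
Qed.

Lemma F2_Q8_action : exists phi : gaction F2 Q8,
  [/\ phi Fa Qx = Qy, phi Fa Qy = Qx * Qy, phi Fb Qx = Qy * Qx & phi Fb Qy = Qx].
Proof.
have [x2 xyV] := Q8_rels; have [xyx yxy zy z2] := q8_facts Q8_rels.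
rewrite !expg2 in x2.
(* [q1] and [q3] concern the images under [phi(a)] and [phi(b)], [q2] and [q4] those under their
   inverses. *)
have q1 : q8_rels Qy (Qx * Qy).
  by apply: q8_intro; rewrite !mulgA ?xyx ?yxy.
have q2 : q8_rels (Qx * Qy) Qx.
  by apply: q8_intro; rewrite !mulgA ?xyx ?yxy.
have q3 : q8_rels (Qy * Qx) Qx.
  by apply: q8_intro; rewrite !mulgA ?yxy // -!mulgA [Qx * (Qy * _)]mulgA xyx mulgA.
have q4 : q8_rels Qy (Qy * Qx).
  by apply: q8_intro; rewrite !mulgA ?yxy // -!mulgA [Qy * (Qx * _)]mulgA yxy.
have [pa [paM pax pay]] : exists p : bij Q8,
    [/\ {morph p : u v / u * v}, p Qx = Qy & p Qy = Qx * Qy].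
  apply: (Q8_aut q1 q2) => f fx fy; rewrite !gmulfM fx fy; split=> //.
    by rewrite mulgA.
have [pb [pbM pbx pby]] : exists p : bij Q8,
    [/\ {morph p : u v / u * v}, p Qx = Qy * Qx & p Qy = Qx].
  apply: (Q8_aut q3 q4) => f fx fy; rewrite !gmulfM fx fy; split=> //.
    by rewrite mulgA.
(* By freeness the two automorphisms define a homomorphism into the permutations of Q8;
   multiplicativity then spreads from [Fa] and [Fb] to all its values. *)
have [r [ra rb]] := F2_lift pa pb.
have rM q : {morph r q : u v / u * v}.
  apply: (presented_ind (P := fun q => {morph r q : u v / u * v})) q.
    split=> [u v|p q pM qM u v|q qM u v]; rewrite ?gmorph1 ?gmulfM ?gmorphV //.
    - by rewrite !bijM qM pM.
    - by apply: (can_inj (bij_funK (r q))); rewrite qM !bij_invK.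
  by case; rewrite ?ra ?rb.
have r1 x : r 1 x = x by rewrite gmorph1.
have rMM p q x : r (p * q) x = r p (r q x) by rewrite gmulfM.
by exists (GAction rM r1 rMM); rewrite /= ra rb.
Qed.

Lemma sdM (Q N : groupType) (phi : gaction Q N) (u v : semidirect phi) :
  u * v = (u.1 * phi u.2 v.1, u.2 * v.2).
Proof. by []. Qed.

(** The map [(u, q) |-> f1 u * f2 q] is multiplicative because [phi] becomes conjugation in
    [presented rel4]. Its inverse sends [g1], [g2], [g3] to [Fa], [Fb], [Qx]. *)
Lemma semidirect4 (phi : gaction F2 Q8) :
  phi Fa Qx = Qy -> phi Fa Qy = Qx * Qy ->
  phi Fb Qx = Qy * Qx -> phi Fb Qy = Qx ->
  exists f : {multiplicative semidirect phi -> presented rel4}, bijective f.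
Proof.
move=> ax ay bx bY; set S : groupType := semidirect phi.
pose K : groupType := presented rel4.
pose n (q : Q8) : S := (q, 1); pose h (q : F2) : S := (1, q).
have nM : {morph n : u v / u * v}.
  by move=> u v; rewrite [RHS]sdM /= act1 mulg1.
have hM : {morph h : u v / u * v}.
  by move=> u v; rewrite [RHS]sdM /= act_one mulg1.
have hn q u : h q * n u = n (phi q u) * h q.
  by rewrite [LHS]sdM [RHS]sdM /= act1 !mul1g !mulg1.
have nh u q : n u * h q = (u, q) by rewrite [LHS]sdM /= act1 mulg1 mul1g.
pose a : K := pgen rel4 G4_1; pose b : K := pgen rel4 G4_2.
pose x : K := pgen rel4 G4_3; pose y : K := a * x * a^-1.
have abx : eqs4 a b x.
  apply/satisfies4; have -> : gen4 a b x = pgen rel4 by apply/funext => -[].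
  exact: satisfies_pgen.
have [qxy [kax kay kbx kby]] := action_of_eqs4 erefl abx.
have [f1 [f1x f1y]] := Q8_lift qxy; have [f2 [f2a f2b]] := F2_lift a b.
have f12 q u : f1 (phi q u) = f2 q * f1 u * (f2 q)^-1.
  move: u; apply: (presented_ind (P := fun q => forall u,
    f1 (phi q u) = f2 q * f1 u * (f2 q)^-1)) q.
    split=> [u|p q IHp IHq u|q IHq u].
    - by rewrite act1 gmorph1 !gnorm.
    - by rewrite act_comp IHp IHq gmulfM !gnorm.
    - have := IHq (phi q^-1 u); rewrite -act_comp mulgV act1 => ->.
      by rewrite gmorphV !gnorm.
  move=> g; have cM : {morph (fun z => f2 (pgen _ g) * z * (f2 (pgen _ g))^-1)
      : u v / u * v} by move=> u v; rewrite !gnorm.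
  have pM : {morph phi (pgen _ g) : u v / u * v} by move=> u v; rewrite actM.
  apply: (Q8_ext (f := f1 \o mk_gmorph pM) (g := mk_gmorph cM \o f1)) => /=.
    case: g {cM pM}; first by rewrite -/Fa ax f2a f1x f1y kax mulgK.
    by rewrite -/Fb bx f2b gmulfM f1x f1y kbx mulgK.
  case: g {cM pM}; first by rewrite -/Fa ay f2a gmulfM f1x f1y kay mulgK.
  by rewrite -/Fb bY f2b f1x f1y kby mulgK.
have fM : {morph (fun z : S => f1 z.1 * f2 z.2) : u v / u * v}.
  by move=> [u p] [v q]; rewrite /= !gmulfM f12 !gnorm.
exists (mk_gmorph fM).
have [g gE] : exists g : {multiplicative K -> S},
    forall c, g (pgen _ c) = gen4 (h Fa) (h Fb) (n Qx) c.
  apply/presented_lift/satisfies4/(@eqs4_of_action _ _ _ _ (n Qy)).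
    have [x2 xyV] := Q8_rels.
    split; first by rewrite !expg2 -!nM -!expg2 x2.
    have nV u : n u^-1 = (n u)^-1 := gmorphV (mk_gmorph nM) u.
    by rewrite -!nV -!nM xyV.
  by split; rewrite hn ?ax ?ay ?bx ?bY // nM.
exists g.
- have gf1 u : g (f1 u) = n u.
    apply: (Q8_ext (f := g \o f1) (g := mk_gmorph nM)) u => /=.
      by rewrite f1x gE.
    by rewrite f1y !gmulfM gmorphV !gE /= hn ax mulgK.
  have gf2 q : g (f2 q) = h q.
    apply: (F2_ext (f := g \o f2) (g := mk_gmorph hM)) q => /=.
      by rewrite f2a gE.
    by rewrite f2b gE.
  by move=> [u q]; rewrite /= gmulfM gf1 gf2 nh.
- apply: (presented_ext (f := mk_gmorph fM \o g) (g := idfun)) => -[] /=.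
  + by rewrite gE /= gmorph1 mul1g f2a.
  + by rewrite gE /= gmorph1 mul1g f2b.
  + by rewrite gE /= gmorph1 mulg1 f1x.
Qed.

End QuaternionExtension.

(** * Three strings *)

Lemma Zp_valM m (x y : 'Z_m) : 1 < m -> val (x * y) = ((val x + val y) %% m)%N.
Proof. by case: m x y => [|[|m]]. Qed.

Lemma expg_Zp m (G : groupType) (g : G) : 1 < m -> g ^+ m = 1 ->
  {morph (fun k : 'Z_m => g ^+ (val k)) : x y / x * y}.
Proof.
move=> m1 gm x y; rewrite Zp_valM // -expgnDr [in RHS](divn_eq (val x + val y) m).
by rewrite expgnDr mulnC expgnA gm expg1n mul1g.
Qed.

Lemma Zp_inv_morph m : {morph (fun k : 'Z_m => k^-1) : x y / x * y}.
Proof. by move=> x y; rewrite invgM Zp_mulgC. Qed.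

Section ThreeStrings.
Variables (B : groupType) (s : nat -> B).
Hypothesis hB : is_sphere_braid_group 3 s.

Lemma sphere3 : [/\ s 1%N ^+ 4 = 1, (s 2%N * (s 1%N)^-1) ^+ 3 = 1
  & s 1%N * (s 2%N * (s 1%N)^-1) = (s 2%N * (s 1%N)^-1)^-1 * s 1%N].
Proof.
have [_ braid] := sb_group_eqs (n := 3) isT hB.
have := braid 1%N isT; rewrite (pal_recl 0) pal1 expg2.
move: (s 1%N) (s 2%N) => a b aba abba.
have bb : b * b = a^-1 * a^-1.
  by have := congr1 (fun x => a^-1 * x * a^-1) abba; rewrite !gnorm.
(* The sphere relation [a b^2 a = 1] gives [b^2 = a^-2], which makes [a^2] central. *)
have zb : commute (a * a) b.
  have -> : a * a = (b * b)^-1 by rewrite bb !gnorm.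
  exact/commute_sym/commuteV/commuteM.
have za : commute (a * a) a by apply/commute_sym/commuteM.
(* [a^3 b = a b a^2 = b a b a = b^2 a b = a^-1 b]. *)
have aV : a * (a * a) = a^-1.
  apply: (mulIg b); rewrite -mulgA zb !mulgA aba.
  by rewrite -[b * a * b]mulgA -[b * (a * b) * a]mulgA aba !mulgA bb mulgVK.
have bb' : b * b = a * a.
  by rewrite bb -invgM; apply: mulg1_eq; rewrite -mulgA aV mulgV.
have baV : b * a^-1 = b^-1 * a.
  by apply: (mulgI b); apply: (mulIg a); rewrite !mulgA mulgVK bb' mulgV mul1g.
have abV : a * b * a^-1 = b^-1 * a * b.
  by apply: (mulgI b); apply: (mulIg a); rewrite !mulgA mulgVK -!mulgA mulVKg
    mulgA -aba mulgA.
split.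
- by rewrite !expgS expg0 mulg1 aV mulgV.
- rewrite !expgS expg0 mulg1 {1}baV [X in _ * (_ * X)]baV.
  rewrite !mulgA -[_ * a * b]mulgA -[_ * (a * b) * a^-1]mulgA abV !mulgA mulgK.
  by rewrite -invgM bb' -mulgA mulVg.
- by rewrite invgM invgK baV mulgA.
Qed.

Let s1 := s 1%N.
Let g := s 2%N * (s 1%N)^-1.

Lemma presents3 : isom_onto 'Z_3 (lcs B 2) /\
  exists phi : gaction 'Z_4 'Z_3, (exists q x, phi q x <> x) /\
    isom_onto (semidirect phi) [set: B]%classic.
Proof.
have [t4 g3 tg] := sphere3; rewrite -/s1 -/g in t4 g3 tg.
have s2E : s 2%N = g * s1 by rewrite mulgVK.
pose f : {multiplicative 'Z_3 -> B} := mk_gmorph (expg_Zp (m := 3) isT g3).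
pose alpha : {multiplicative 'Z_3 -> 'Z_3} := mk_gmorph (@Zp_inv_morph 3).
pose c : 'Z_3 := Ordinal (isT : 1 < 3).
have fc : f c = g by [].
have f_alpha k : s1 * f k = f (alpha k) * s1.
  have -> : f (alpha k) = (f k)^-1 := gmorphV f k.
  rewrite /=; elim: (nat_of_ord k) => [|j IHj]; first by rewrite invg1 mulg1 mul1g.
  by rewrite [in LHS]expgS mulgA tg -mulgA IHj mulgA -invgM -expgSr.
have [f_inj f_range] : injective f /\ range f = lcs B 2.
  (* Here [2n - 2 = 4], [sigma_1] acts on ['Z_3] by inversion, and [w = 1] since [sigma_1^4 = 1]. *)
  apply: (cyclic_quotient hB (f := f) (alpha := alpha) (w := 1) (p := 3) (t := ord0)
    (c := fun i : 'I_2 => if i == ord0 then 1 else c)) => //.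
  - exact: gmorph1.
  - by move=> k; rewrite /= !invgK mul1g invg1 mulg1.
  - case=> [[|[|i]] lti] //=; first by rewrite mul1g.
  - move=> k; have [N1 NM _] := lcs_subgroup B 2.
    have Ng : lcs B 2 g := lcs2_generators (n := 3) isT hB (i := 1) isT.
    rewrite /=; elim: (nat_of_ord k) => // i IHi; rewrite expgS; exact: NM.
  - move=> E L T TL T4; set r := fun _ => _.
    have -> : r = fun i : 'I_2 => if i.+1 == 2 then L c * T else T.
      by apply/funext => -[[|[|i]] lti] //=; rewrite /r /= ?gmorph1 ?mul1g.
    apply/(@satisfies_sphere_braid 3 isT _ (fun i => if i == 2 then L c * T else T)).
    have TLc : T * L c = L c^-1 * T by rewrite TL.
    have TLcV : T * L c^-1 = L c * T by rewrite TL /= invgK.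
    have cc : L c^-1 = L c * L c by rewrite -gmulfM; congr (L _); apply: val_inj.
    have T2 : T * T * L c = L c * (T * T) by rewrite -mulgA TLc mulgA TLcV -mulgA.
    split=> [[|[|[|i]]] [|[|[|j]]] //|[|[|i]] // _|].
    + rewrite /= !mulgA TLc -[L c * T * T]mulgA -[_ * (T * T) * L c]mulgA T2.
      by rewrite !mulgA -cc.
    + rewrite (pal_recl 0) pal1 /= expg2 !mulgA TLc.
      rewrite -[L c^-1 * T * T]mulgA -[_ * (T * T) * L c]mulgA T2.
      rewrite !mulgA -gmulfM mulVg.
      by rewrite gmorph1 mul1g -[RHS](gmorph1 L) -T4 !expgS expg0 mulg1 !mulgA.
  - move=> E L h hL hm hs k; rewrite /= gmorphX.
    have -> : h g = L c.
      by rewrite gmulfM gmorphV (hs (Ordinal (isT : 1 < 2))) mulgK.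
    by rewrite -gmorphX; congr (L _); rewrite Zp_expg mul1n valZpK.
split; first by exists f.
pose act (q : 'Z_4) (x : 'Z_3) := if odd q then x^-1 else x.
have actM q : {morph act q : x y / x * y}.
  by rewrite /act; case: odd => // x y; apply: Zp_inv_morph.
have act1 x : act 1 x = x by [].
have actMM p q x : act (p * q) x = act p (act q x).
  rewrite /act; have -> : odd (p * q)%g = odd p (+) odd q.
    by rewrite -[nat_of_ord _]/(val (p * q)) Zp_valM // odd_mod // oddD.
  by case: odd; case: odd => /=; rewrite ?invgK.
exists (GAction actM act1 actMM); split.
  by exists (Ordinal (isT : 1 < 4)), c => /(congr1 val).
set S := semidirect _.
pose F (u : S) : B := f u.1 * s1 ^+ (u.2 : 'Z_4).
have s1X j k : s1 ^+ j * f k = f (if odd j then k^-1 else k) * s1 ^+ j.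
  elim: j => [|j IHj] /=; first by rewrite mul1g mulg1.
  rewrite expgS -mulgA IHj !mulgA f_alpha; congr (f _ * _ * _).
  by rewrite /=; case: odd => //=; rewrite invgK.
have FM : {morph F : u v / u * v}.
  move=> [k q] [l r]; rewrite -[LHS]/(f (k * act q l) * s1 ^+ val (q * r)) /F.
  rewrite gmulfM (expg_Zp (m := 4) isT t4 q r) /fst /snd.
  by rewrite !mulgA -[_ * s1 ^+ q * f l]mulgA s1X !mulgA.
exists (mk_gmorph FM); split.
- apply: gmorph_inj => -[k q]; rewrite /F /= => Fkq.
  pose d : 'Z_4 := Ordinal (isT : 1 < 4).
  (* Sending every [sigma_i] to the generator of ['Z_4] kills the image of [f], so [chi] recovers
     the second coordinate of a pair from its image under [F]. *)
  have [chi chis] : exists chi : {multiplicative B -> 'Z_4},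
      forall i : 'I_2, chi (s i.+1) = d.
    apply: (presents_lift hB).
    apply/(@satisfies_sphere_braid 3 isT _ (fun=> d)).
    split=> [[|[|[|i]]] [|[|[|j]]] //|[|[|i]] // _|//].
    by rewrite (pal_recl 0) pal1; apply: val_inj.
  have chif : chi (f k) = 1.
    rewrite /= gmorphX gmulfM gmorphV (chis (Ordinal (isT : 1 < 2))) (chis ord0).
    rewrite mulgV.
    exact: expg1n.
  have := congr1 chi Fkq; rewrite gmulfM chif mul1g gmorphX (chis ord0) gmorph1.
  rewrite Zp_expg mul1n valZpK => q1; congr pair => //; apply: f_inj.
  by move: Fkq; rewrite q1 mulg1 gmorph1.
- apply/seteqP; split=> // b _; move: b; apply: (presents_ind hB).
    exact: range_subgroup.
  case=> [[|[|i]] lti] //=.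
  + by exists ((1, Ordinal (isT : 1 < 4)) : S) => //=; rewrite /F /= mul1g.
  + by exists ((c, Ordinal (isT : 1 < 4)) : S) => //=; rewrite s2E.
Qed.

End ThreeStrings.

(** * Assembly of the cases by number of strings *)

Theorem theorem3 (n : nat) (B : groupType) (sigma : nat -> B)
    (n_gt0 : 0 < n) (hB : is_sphere_braid_group n sigma) :
  (2 <= n -> forall m : nat, 2 <= m -> lcs B m = lcs B 2)
  /\ (n = 1%N \/ n = 2 -> lcs B 2 = [set (1 : B)]%classic)
  /\ (n = 3 ->
        isom_onto 'Z_3 (lcs B 2)
        /\ exists phi : gaction 'Z_4 'Z_3,
             (exists q x, phi q x <> x)
             /\ isom_onto (semidirect phi) [set: B]%classic)
  /\ (n = 4 ->
        presents (lcs B 2) (family4 sigma) rel4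
        /\ exists phi : gaction F2 Q8,
             [/\ phi Fa Qx = Qy, phi Fa Qy = Qx * Qy,
                 phi Fb Qx = Qy * Qx & phi Fb Qy = Qx]
             /\ isom_onto (semidirect phi) (lcs B 2))
  /\ (n = 5 -> presents (lcs B 2) (family5 sigma) rel5)
  /\ (6 <= n -> presents (lcs B 2) (family6 (n := n) sigma) (rel6 n)).
Proof.
split=> [n2|].
  apply: (lcs_stable hB (t := sigma 1%N)) => x.
  by apply: (lcs2_generators n2 hB); have := ltn_ord x; lia.
split=> [n12|].
  (* For [n <= 2] there is at most one generator. *)
  apply: (lcs2_trivial hB) => x y; suff -> : x = y by [].
  by apply: ord_inj; have := ltn_ord x; have := ltn_ord y; lia.
split=> [n3|]; first by subst n; apply: presents3 hB.
split=> [n4|].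
  subst n; have p4 := presents4 hB; split=> //.
  have [phi phiE] := F2_Q8_action; exists phi; split=> //.
  have [ax ay bx bY] := phiE.
  have [h [k hk kh]] := semidirect4 ax ay bx bY; have [f [f_inj f_range _]] := p4.
  exists (f \o h); split.
    by apply: inj_comp f_inj (can_inj hk).
  rewrite -f_range; apply/seteqP; split=> [_ [x _ <-]|_ [x _ <-]].
    by exists (h x).
  by exists (k x) => //=; rewrite kh.
split=> [n5|n6]; first by subst n; apply: presents5.
case: n n6 {n_gt0} hB => [|[|[|[|p]]]] // p2 hB; exact: presents6.
Qed.
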